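(* Let $n\ge2$ and let $U(x)$ be a complex polynomial of degree $2n$ such that $-U$ is monic. Write $-U(x)=A(x)^2+B(x)$ with $A$ monic of degree $n$ and $B(x)=\sum_{j=0}^{n-1}b_jx^j$, and let $d=\frac{|b_{n-1}|-n}{2}$ (the arithmetic condition of $U$). If for some $\lambda\in\mathbb{C}$ the Schrödinger equation $\psi''=(\lambda-U(x))\psi$ has a Liouvillian solution, then $d$ is a non-negative integer; and in that case the number of values $\lambda\in\mathbb{C}$ for which $\psi''=(\lambda-U(x))\psi$ has a Liouvillian solution is at most $d+1$.
   Context: A Liouvillian solution means a nonzero solution lying in a Liouvillian differential field extension of $(\mathbb{C}(x),d/dx)$. The decomposition $-U=A^2+B$ with $A$ monic of degree $n$ and $\deg B\le n-1$ exists and is unique (completion of squares); since $n\ge2$, adding $\lambda$ changes only $b_0$, so $d$ does not depend on $\lambda$. *)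

(* Defs.v *)
From HB Require Import structures.
From mathcomp Require Import all_boot all_order all_algebra.
Set Implicit Arguments. Unset Strict Implicit. Unset Printing Implicit Defensive.
Import Order.TTheory GRing.Theory Num.Theory.
Local Open Scope ring_scope.

Definition is_derivation (K : fieldType) (D : K -> K) : Prop :=
  (forall a b, D (a + b) = D a + D b) /\ (forall a b, D (a * b) = D a * b + a * D b).

Inductive gen_field (K : fieldType) (S : K -> Prop) : K -> Prop :=
  | gen_in a : S a -> gen_field S a
  | gen_one : gen_field S 1
  | gen_add a b : gen_field S a -> gen_field S b -> gen_field S (a + b)
  | gen_opp a : gen_field S a -> gen_field S (- a)
  | gen_mul a b : gen_field S a -> gen_field S b -> gen_field S (a * b)
  | gen_inv a : gen_field S a -> gen_field S (a^-1).

(* Generators of the i-th field of the tower: the constants iota(C), the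
   element x (with D x = 1, playing the role of the variable of C(x)), and
   the first i adjoined elements t_0, ..., t_{i-1}. *)
Definition tower_gens (C : numClosedFieldType) (K : fieldType)
    (iota : {rmorphism C -> K}) (x : K) (ts : seq K) (i : nat) : K -> Prop :=
  fun y => (exists c, y = iota c) \/ y = x \/
           (exists j, (j < i)%N /\ y = nth 0 ts j).

Definition liouville_step (K : fieldType) (D : K -> K) (F : K -> Prop) (t : K) : Prop :=
  (exists p : {poly K}, p != 0 /\ (forall j, F p`_j) /\ root p t)
  \/ F (D t)
  \/ (t != 0 /\ F (D t / t)).

(* The equation psi'' = V(x) psi over (C(x), d/dx) has a Liouvillian solution:
   a nonzero solution lying in a Liouvillian differential field extension
   C(x)(t_0,...,t_{m-1}) of C(x), realized inside some differential field K. *)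
Definition has_liouvillian_solution (C : numClosedFieldType) (V : {poly C}) : Prop :=
  exists (K : fieldType) (iota : {rmorphism C -> K}) (D : K -> K) (x : K)
         (ts : seq K) (psi : K),
    is_derivation D /\
        (forall c, D (iota c) = 0) /\
        D x = 1 /\
        (forall i, (i < size ts)%N ->
           liouville_step D (gen_field (tower_gens iota x ts i)) (nth 0 ts i)) /\
        gen_field (tower_gens iota x ts (size ts)) psi /\
        psi != 0 /\
        D (D psi) = (map_poly iota V).[x] * psi.

Definition arith_cond (C : numClosedFieldType) (n : nat) (B : {poly C}) : C :=
  (`|B`_(n.-1)| - n%:R) / 2%:R.

(* Main.v *)
Require Import Defs.
From HB Require Import structures.
From mathcomp Require Import all_boot all_order all_algebra.
From mathcomp Require Import perm zify ring.
From Stdlib Require Import Classical.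
Set Implicit Arguments. Unset Strict Implicit. Unset Printing Implicit Defensive.
Import Order.TTheory GRing.Theory Num.Theory.
Local Open Scope ring_scope.

(** Extend the derivation of a differential field [F] to [F[X]] by [X' = V - X^2], and call
    [P] in [F[X]] Darboux if it divides [P']; its roots then solve the Riccati equation
    [u' + u^2 = V] of [psi'' = V psi].  If [psi] is a solution, [X - psi'/psi] is Darboux,
    and Darboux polynomials descend along a Liouvillian tower: for [t] algebraic over [F]
    take the norm, for [t] transcendental with [t'] of degree at most one in [t] take the
    leading coefficient in [t].  So there is a Darboux [P] over [C(x)], which may be taken
    primitive in [C[x][X]] and coprime to its [X]-derivative; then [P' = (al - m X) P] with
    [al] in [C[x]] and [m] the degree of [P].  If [m >= 2] the discriminant [Delta] of [P] is
    a nonzero polynomial with [Delta' = 2 (m - 1) al Delta], hence [al = 0], and comparing leading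
    coefficients in [x] gives a contradiction.  So [m = 1], that is, there is a solution
    [p exp(-int al)] with [p] and [al] polynomials, and [al = A] or [al = -A] by comparison
    of degrees.  Then [b_(n-1) = +-(2 deg p + n)], where the sign does not depend on
    [lambda], and the [p] are eigenvectors, for the eigenvalues [lambda], of one operator
    on polynomials of degree at most [d]. *)

(** * Derivations *)

Definition derivation (R : nzRingType) (D : R -> R) : Prop :=
  (forall a b, D (a + b) = D a + D b) /\
  (forall a b, D (a * b) = D a * b + a * D b).

Section Derivation.
Variables (R : comNzRingType) (D : R -> R).
Hypothesis derD : derivation D.

Lemma der_add a b : D (a + b) = D a + D b. Proof. exact: derD.1. Qed.
Lemma der_mul a b : D (a * b) = D a * b + a * D b. Proof. exact: derD.2. Qed.

Lemma der0 : D 0 = 0.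
Proof. by apply: (addIr (D 0)); rewrite -der_add !add0r. Qed.

Lemma der1 : D 1 = 0.
Proof.
by apply: (addIr (D 1)); rewrite add0r -[RHS](congr1 D (mulr1 1)) der_mul mulr1 mul1r.
Qed.

Lemma der_opp a : D (- a) = - D a.
Proof. by apply: (addIr (D a)); rewrite -der_add !addNr der0. Qed.

Lemma der_sub a b : D (a - b) = D a - D b.
Proof. by rewrite der_add der_opp. Qed.

Lemma der_sum I r (P : pred I) (F : I -> R) :
  D (\sum_(i <- r | P i) F i) = \sum_(i <- r | P i) D (F i).
Proof. exact: (big_morph D der_add der0). Qed.

Lemma der_nat n : D n%:R = 0.
Proof. by elim: n => [|n IH]; rewrite ?der0 // -natr1 der_add IH der1 addr0. Qed.

Lemma der_prod n (F : 'I_n -> R) :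
  D (\prod_i F i) = \sum_i \prod_j (if j == i then D (F j) else F j).
Proof.
elim: n F => [|n IH] F; first by rewrite !big_ord0 der1.
rewrite big_ord_recl der_mul IH [RHS]big_ord_recl; congr (_ + _).
  by rewrite big_ord_recl eqxx.
rewrite mulr_sumr; apply: eq_bigr => i _; rewrite [RHS]big_ord_recl; congr (_ * _).
Qed.

(** Jacobi's formula: [D] acts on one row at a time, and expanding along that row meets cofactors
    free of [D]. *)
Lemma der_det n (A : 'M[R]_n) : D (\det A) = \tr (map_mx D A *m \adj A).
Proof.
rewrite /determinant der_sum.
transitivity (\sum_i \det (\matrix_(k, j) if k == i then D (A k j) else A k j)).
  rewrite exchange_big /=; apply: eq_bigr => s _.
  have -> : D ((-1) ^+ s * \prod_i A i (s i)) = (-1) ^+ s * D (\prod_i A i (s i)).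
    by case: (odd_perm s); rewrite ?expr1 ?expr0 ?mul1r ?mulN1r ?der_opp.
  rewrite der_prod mulr_sumr; apply: eq_bigr => i _; congr (_ * _).
  by apply: eq_bigr => k _; rewrite mxE.
apply: eq_bigr => i _; rewrite mxE (expand_det_row _ i).
apply: eq_bigr => j _; rewrite !mxE eqxx; congr (_ * _).
rewrite /cofactor; congr (_ * \det _).
by apply/matrixP => a b; rewrite !mxE eq_sym (negPf (neq_lift _ _)).
Qed.

(** An Abel-Liouville formula: cyclicity of the trace turns both products into [\det A] times a
    trace. It yields the differential equation of the discriminant. *)
Lemma der_det_lin n (A N1 N2 : 'M[R]_n) : map_mx D A = N1 *m A - A *m N2 ->
  D (\det A) = (\tr N1 - \tr N2) * \det A.
Proof.
move=> eA; rewrite der_det eA mulmxBl linearB /= -!mulmxA mul_mx_adj.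
rewrite [\tr (A *m _)]mxtrace_mulC -mulmxA mul_adj_mx.
by rewrite !mul_mx_scalar !mxtraceZ; ring.
Qed.

(* [riccati_der V] extends [D] to polynomials by [X' = V - X^2]; a root [u] of a
   polynomial [P] dividing [riccati_der V P] satisfies [u' + u^2 = V]. *)
Definition riccati_der (V : R) (P : {poly R}) : {poly R} :=
  map_poly D P + (V%:P - 'X^2) * P^`().

Lemma coef_map_der P i : (map_poly D P)`_i = D P`_i.
Proof. by rewrite coef_map_id0 ?der0. Qed.

Lemma derivation_map_poly : derivation (map_poly D).
Proof.
split=> P Q; apply/polyP=> i; rewrite ?coefD !coef_map_der ?coefD ?der_add //.
rewrite !coefM der_sum -big_split /=; apply: eq_bigr => j _.
by rewrite der_mul !coef_map_der.
Qed.

Lemma derivation_riccati V : derivation (riccati_der V).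
Proof.
rewrite /riccati_der; split=> P Q.
  by rewrite derivation_map_poly.1 derivD; ring.
by rewrite derivation_map_poly.2 derivM; ring.
Qed.

Lemma coef_riccati0 V P : (riccati_der V P)`_0 = D P`_0 + V * P`_1.
Proof.
by rewrite coefD coef_map_der mulrBl coefB coefCM coefXnM coef_deriv mulr1n subr0.
Qed.

Lemma coef_riccatiS V P i : (riccati_der V P)`_i.+1 =
  D P`_i.+1 + V * (P`_i.+2 *+ i.+2) - P`_i *+ i.
Proof.
rewrite coefD coef_map_der mulrBl coefB coefCM coefXnM !coef_deriv -addrA.
by case: i => [|i] /=; rewrite ?subn2.
Qed.

Lemma size_riccati V P : (size (riccati_der V P) <= (size P).+1)%N.
Proof.
apply/leq_sizeP => j hj; case: j hj => // j hj.
by rewrite coef_riccatiS !nth_default ?mul0rn ?der0 ?mulr0 ?addr0 ?subr0 //; do ?[apply: leqW].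
Qed.

Lemma riccati_derC V c : riccati_der V c%:P = (D c)%:P.
Proof.
rewrite /riccati_der derivC mulr0 addr0; apply/polyP=> i.
by rewrite coef_map_der !coefC; case: eqP; rewrite ?der0.
Qed.

(** The commutator with [d/dX] is [2 X d/dX], because [V - X^2] has [X]-derivative [-2 X]. *)
Lemma riccati_der_deriv V P :
  riccati_der V P^`() = (riccati_der V P)^`() + 2%:R * 'X * P^`().
Proof.
have e : map_poly D P^`() = (map_poly D P)^`().
  apply/polyP=> i; rewrite coef_deriv !coef_map_der coef_deriv.
  by rewrite -[X in D X]mulr_natl -[RHS]mulr_natl der_mul der_nat mul0r add0r.
rewrite /riccati_der derivD derivM derivB derivC derivXn expr1 -e sub0r.
by move: (map_poly D P^`()) => a; ring.
Qed.

End Derivation.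

Lemma coefM_top (R : comNzRingType) (p q : {poly R}) i j :
  (size p <= i.+1)%N -> (size q <= j.+1)%N -> (p * q)`_(i + j) = p`_i * q`_j.
Proof.
move=> hp hq; rewrite coefM (bigD1 (inord i)) //= inordK ?ltnS ?leq_addr // addKn.
rewrite big1 ?addr0 // => k hk.
have : nat_of_ord k != i.
  by apply: contra hk => /eqP e; apply/eqP/val_inj; rewrite /= inordK // ltnS leq_addr.
rewrite neq_ltn => /orP[lt|gt]; last by rewrite nth_default ?mul0r // (leq_trans hp).
by rewrite [q`__]nth_default ?mulr0 // (leq_trans hq) // ltn_subRL ltn_add2r.
Qed.

Lemma size_le_mul (R : comNzRingType) (p q : {poly R}) i j :
  (size p <= i.+1)%N -> (size q <= j.+1)%N -> (size (p * q)%R <= (i + j).+1)%N.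
Proof.
move=> hp hq; apply: leq_trans (size_polyMleq _ _) _.
by rewrite -[(i + j).+1]/((i + j).+2.-1) -!subn1 leq_sub2r // -addSn -addnS leq_add.
Qed.


(** * Subrings and algebraic elements *)

Record subring_pred (R : comNzRingType) (F : R -> Prop) : Prop := SubringPred {
  sr1 : F 1;
  srD : forall a b, F a -> F b -> F (a + b);
  srN : forall a, F a -> F (- a);
  srM : forall a b, F a -> F b -> F (a * b) }.

Definition coefs_in (R : comNzRingType) (F : R -> Prop) (p : {poly R}) : Prop := forall i, F p`_i.

Section Subring.
Variables (R : comNzRingType) (F : R -> Prop).
Hypothesis srF : subring_pred F.

Lemma sr0 : F 0.
Proof. by rewrite -(subrr 1); apply: (srD srF) => //; [|apply: (srN srF)]; apply: (sr1 srF). Qed.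

Lemma srB a b : F a -> F b -> F (a - b).
Proof. by move=> Fa Fb; apply: (srD srF) => //; apply: (srN srF). Qed.

Lemma sr_sum (I : Type) (r : seq I) (P : pred I) (G : I -> R) :
  (forall i, P i -> F (G i)) -> F (\sum_(i <- r | P i) G i).
Proof. by move=> h; apply: big_ind => //; [exact: sr0 | exact: (srD srF)]. Qed.

Lemma sr_prod (I : Type) (r : seq I) (P : pred I) (G : I -> R) :
  (forall i, P i -> F (G i)) -> F (\prod_(i <- r | P i) G i).
Proof. by move=> h; apply: big_ind => //; [exact: (sr1 srF) | exact: (srM srF)]. Qed.

Lemma sr_natmul a n : F a -> F (a *+ n).
Proof. by move=> Fa; elim: n => [|n IH]; rewrite ?mulrS; [exact: sr0|exact: (srD srF)]. Qed.

Lemma sr_det n (A : 'M[R]_n) : (forall i j, F (A i j)) -> F (\det A).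
Proof.
move=> h; apply: sr_sum => s _; apply: (srM srF); last by apply: sr_prod.
by case: (odd_perm s); rewrite ?expr0 ?expr1; [apply: (srN srF)|]; apply: (sr1 srF).
Qed.

Lemma coefs_inC c : F c -> coefs_in F c%:P.
Proof. by move=> Fc i; rewrite coefC; case: eqP => // _; apply: sr0. Qed.

Lemma coefs_inXn n : coefs_in F 'X^n.
Proof. by move=> i; rewrite coefXn; case: eqP => _; [apply: (sr1 srF)|apply: sr0]. Qed.

Lemma coefs_inX : coefs_in F 'X.
Proof. exact: (coefs_inXn 1). Qed.

Lemma coefs_in_deriv p : coefs_in F p -> coefs_in F p^`().
Proof. by move=> h i; rewrite coef_deriv; apply: sr_natmul. Qed.

Lemma subring_coefs_in : subring_pred (coefs_in F).
Proof.
split.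
- exact: coefs_inC (sr1 srF).
- by move=> a b ha hb i; rewrite coefD; apply: (srD srF).
- by move=> a ha i; rewrite coefN; apply: (srN srF).
- by move=> a b ha hb i; rewrite coefM; apply: sr_sum => j _; apply: (srM srF).
Qed.

Lemma coefs_inZ a p : F a -> coefs_in F p -> coefs_in F (a *: p).
Proof. by move=> Fa hp i; rewrite coefZ; apply: (srM srF). Qed.

Lemma sr_horner p t : F t -> coefs_in F p -> F p.[t].
Proof.
move=> Ft hp; rewrite horner_coef; apply: sr_sum => i _; apply: (srM srF) => //.
by elim: (i : nat) => [|k IH]; rewrite ?expr0 ?exprS; [apply: (sr1 srF)|apply: (srM srF)].
Qed.

End Subring.

Lemma coefs_in_comp (R : comNzRingType) (F : R -> Prop) p q : subring_pred F ->
  coefs_in F p -> coefs_in F q -> coefs_in F (p \Po q).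
Proof.
move=> srF hp hq; rewrite comp_polyE; apply: sr_sum => [|i _]; first exact: subring_coefs_in.
apply: coefs_inZ => //; elim: (i : nat) => [|k IH]; rewrite ?expr0 ?exprS.
  exact: (sr1 (subring_coefs_in srF)).
exact: (srM (subring_coefs_in srF)).
Qed.

Lemma coefs_in_modp (K : fieldType) (F : K -> Prop) (p f : {poly K}) :
  subring_pred F -> p \is monic -> coefs_in F p -> coefs_in F f -> coefs_in F (f %% p).
Proof.
move=> srF mp hp hf.
have [k hk] := ubnP (size f); elim: k => // k IH in f hf hk *.
have [lt|le] := ltnP (size f) (size p); first by rewrite modp_small.
have p0 := monic_neq0 mp.
have f0 : f != 0 by rewrite -size_poly_gt0 (leq_trans _ le) // size_poly_gt0.
pose g := f - (lead_coef f *: 'X^(size f - size p)) * p.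
have hg : coefs_in F g.
  apply: (srB (subring_coefs_in srF)) => //; apply: (srM (subring_coefs_in srF)) => //.
  by apply: coefs_inZ => //; [apply: hf | apply: coefs_inXn].
have -> : f %% p = g %% p by rewrite /g -mulNr modpD modp_mull addr0.
apply: IH => //; rewrite -ltnS (leq_trans _ hk) // ltnS.
have sz : size ((lead_coef f *: 'X^(size f - size p)) * p) = size f.
  by rewrite -scalerAl size_scale ?lead_coef_eq0 // mulrC size_mulXn // subnK.
rewrite -(prednK (n := size f)) ?size_poly_gt0 // ltnS; apply/leq_sizeP => j.
rewrite leq_eqVlt => /orP[/eqP <-|].
  rewrite /g coefB -/(lead_coef f) -[X in _ - _`_X.-1]sz -/(lead_coef _).
  by rewrite lead_coefM lead_coefZ lead_coefXn mulr1 (monicP mp) mulr1 subrr.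
rewrite prednK ?size_poly_gt0 // => lj.
by rewrite /g coefB !nth_default ?sz ?subr0.
Qed.

Section Algebraic.
Variables (K : fieldType) (F : K -> Prop).
Hypothesis srF : subring_pred F.
Hypothesis srV : forall a, F a -> F a^-1.
Variable t : K.

Definition alg_over : Prop := exists p : {poly K}, [/\ p != 0, coefs_in F p & p.[t] = 0].

Lemma alg_over_monic : alg_over -> exists p : {poly K}, [/\ p \is monic, coefs_in F p & p.[t] = 0].
Proof.
case=> p [p0 hp rt]; exists ((lead_coef p)^-1 *: p); split.
- by rewrite monicE lead_coefZ mulVf ?lead_coef_eq0.
- by apply: coefs_inZ => //; apply: srV; apply: hp.
- by rewrite hornerZ rt mulr0.
Qed.

(* The multiple of [Q] is its norm from [F(t)[X]] to [F[X]]: the determinant of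
   multiplication by [Q] on the powers of [t]. *)
Lemma alg_over_multiple (Q : {poly K}) : alg_over -> Q \is monic ->
  (forall k, exists2 g, coefs_in F g & Q`_k = g.[t]) ->
  exists f : {poly K}, [/\ f != 0, coefs_in F f & Q %| f].
Proof.
move=> /alg_over_monic[p [mp hp rt]] mQ hQ.
have p0 := monic_neq0 mp; have Q0 := monic_neq0 mQ.
pose m := (size Q).-1; have sQ : size Q = m.+1 by rewrite /m prednK // size_poly_gt0.
(* Each coefficient of [Q] is written as a polynomial in [t]; taking exactly [1] for the top one
   confines [X^m] to the diagonal of [A]. *)
have /fin_all_exists[q hq] (k : 'I_m.+1) : exists q : {poly K},
    [/\ coefs_in F q, Q`_k = q.[t] & nat_of_ord k = m -> q = 1].
  have [/eqP km|km] := boolP (nat_of_ord k == m).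
    exists 1; split=> //; first exact: (sr1 (subring_coefs_in srF)).
    by rewrite hornerC km -/(lead_coef Q) (monicP mQ).
  by have [g hg e] := hQ k; exists g; split=> // e'; rewrite e' eqxx in km.
have sp : (1 < size p)%N.
  rewrite ltnNge; apply/negP => /size1_polyC e; move: rt p0.
  by rewrite e hornerC => ->; rewrite eqxx.
pose e := (size p).-1; have se : size p = e.+1 by rewrite /e prednK // size_poly_gt0.
(* Row [i] gives [t^i Q] on the powers of [t], reduced modulo [p]; [p] may be reducible, so
   [\det A != 0] needs its own argument. *)
pose A : 'M[{poly K}]_e := \matrix_(i, j) \poly_(k < m.+1) (('X^i * q (inord k)) %% p)`_j.
have szA (i j : 'I_e) : (size (A i j - ('X^m *+ (i == j))%R)%R <= m)%N.
  apply/leq_sizeP => k hk; rewrite mxE coefB coefMn coef_poly coefXn.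
  move: hk; rewrite leq_eqVlt => /orP[/eqP <-|hk].
    rewrite ltnSn eqxx; have [_ _ -> //] := hq (inord m); last by rewrite inordK.
    rewrite mulr1 modp_small ?size_polyXn ?se ?ltnS ?ltn_ord // coefXn eq_sym.
    by rewrite -(inj_eq val_inj); case: eqP => _; rewrite subrr.
  by rewrite ltnS leqNgt hk /= gtn_eqF // mul0rn subrr.
exists (\det A); split.
(* In a kernel vector, an entry of largest degree in [X] cannot be cancelled: on the diagonal it is
   multiplied by [X^m], and all other terms have lower degree. *)
- apply/negP => /det0P[v v0 vA].
  have [i0 hi0] : exists i0, v 0 i0 != 0.
    apply/existsP; apply: contraR v0; rewrite negb_exists => /forallP h.
    by apply/eqP/rowP => j; rewrite mxE; apply/eqP; rewrite -[_ == _]negbK h.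
  pose i := [arg max_(i > i0) size (v 0%R i)]%N.
  have hi j : (size (v 0%R j) <= size (v 0%R i))%N.
    by rewrite /i; case: arg_maxnP => // i' _ h; apply: h.
  have vi0 : v 0 i != 0.
    by rewrite -size_poly_gt0 (leq_trans _ (hi i0)) // size_poly_gt0.
  have /rowP/(_ i) := vA; rewrite mxE [RHS]mxE.
  pose B := fun j : 'I_e => A j i - 'X^m *+ (j == i).
  have -> : \sum_j v 0 j * A j i = v 0 i * 'X^m + \sum_j v 0 j * B j.
    rewrite /B; under [in RHS]eq_bigr do rewrite mulrBr.
    rewrite sumrB [X in _ + (_ - X)](bigD1 i) //= eqxx mulr1n [X in _ - (_ + X)]big1 ?addr0.
      by rewrite addrC subrK.
    by move=> j /negPf ->; rewrite mulr0n mulr0.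
  have hs : (size (\sum_j v 0 j * B j)%R < size (v 0 i * 'X^m)%R)%N.
    rewrite size_mulXn // (leq_ltn_trans (size_sum _ _ _)) //.
    rewrite -(prednK (n := (m + size (v 0%R i))%N)) ?ltnS; last by rewrite addn_gt0 size_poly_gt0 vi0 orbT.
    apply/bigmax_leqP => j _; apply: leq_trans (size_polyMleq _ _) _.
    by rewrite -!subn1 leq_sub2r // addnC; apply: leq_add; [apply: szA|apply: hi].
  by move/eqP; rewrite -size_poly_eq0 size_polyDl // size_mulXn // addn_eq0 size_poly_eq0 (negPf vi0) andbF.
- apply: (sr_det (subring_coefs_in srF)) => i j k; rewrite mxE coef_poly.
  case: ifP => _; last exact: (sr0 srF).
  apply: coefs_in_modp => //; apply: (srM (subring_coefs_in srF)); first exact: coefs_inXn.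
  by have [] := hq (inord k).
(* The column of powers of [t] is an eigenvector of [A] for [Q]. Multiplying by the adjugate and
   reading the entry of index [0], where [t^0 = 1], exhibits [\det A] as a multiple of [Q]. *)
- have e0 : (0 < e)%N by rewrite -ltnS -se.
  pose v : 'cV[{poly K}]_e := \col_j (t ^+ j)%:P.
  have Av : A *m v = Q *: v.
    apply/colP => i; rewrite !mxE; apply/polyP => k.
    rewrite coef_sum coefMC.
    have -> : \sum_j (A i j * v j 0)`_k = if (k < m.+1)%N then
       \sum_(j < e) (('X^i * q (inord k)) %% p)`_j * t ^+ j else 0.
      case: ifP => hk; last by rewrite big1 // => j _; rewrite !mxE coefMC coef_poly hk mul0r.
      by apply: eq_bigr => j _; rewrite !mxE coefMC coef_poly hk.
    case: ltnP => hk; last by rewrite nth_default ?sQ ?mul0r.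
    have hsz : (size (('X^i * q (inord k)) %% p)%R <= e)%N by rewrite -ltnS -se ltn_modp.
    rewrite -(horner_coef_wide _ hsz).
    have -> : (('X^i * q (inord k)) %% p).[t] = ('X^i * q (inord k)).[t].
      by rewrite [in RHS](divp_eq ('X^i * q (inord k)) p) hornerD hornerM rt mulr0 add0r.
    have [_ eQ _] := hq (inord k); rewrite inordK // in eQ.
    by rewrite hornerM hornerXn eQ mulrC.
  have /colP/(_ (Ordinal e0)) : \adj A *m (A *m v) = \det A *: v.
    by rewrite mulmxA mul_adj_mx mul_scalar_mx.
  rewrite Av -scalemxAr !mxE expr0 mulr1 => <-; exact: dvdp_mulr.
Qed.

End Algebraic.

(** * Field extensions by one element, and derivations on them *)

Section GenField.
Variable K : fieldType.

Record subfield_pred (F : K -> Prop) : Prop := SubfieldPred {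
  sf_ring : subring_pred F;
  sfV : forall a, F a -> F a^-1 }.

Lemma subfield_gen (S : K -> Prop) : subfield_pred (gen_field S).
Proof. by split; [split|]; [exact: gen_one|exact: gen_add|exact: gen_opp|exact: gen_mul|exact: gen_inv]. Qed.

Lemma gen_field_min (S F : K -> Prop) : subfield_pred F -> (forall s, S s -> F s) ->
  forall y, gen_field S y -> F y.
Proof.
move=> [srF iF] h y; elim=> {y} [a /h //||a b _ ha _ hb|a _ ha|a b _ ha _ hb|a _ ha].
- exact: sr1.
- exact: srD.
- exact: srN.
- exact: srM.
- exact: iF.
Qed.

Definition adjoin (F : K -> Prop) (t y : K) : Prop := F y \/ y = t.

Lemma der_inv (D : K -> K) a : derivation D -> D a^-1 = - D a / a ^+ 2.
Proof.
move=> derD; have [->|a0] := eqVneq a 0; first by rewrite invr0 der0 // oppr0 mul0r.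
have h : D a * a^-1 + a * D a^-1 = 0 by rewrite -(der_mul derD) divff // der1.
apply: (mulfI a0); apply: (addrI (D a * a^-1)); rewrite h; field => //.
Qed.

Lemma gen_field_der (D : K -> K) (S : K -> Prop) : derivation D ->
  (forall s, S s -> gen_field S (D s)) -> forall y, gen_field S y -> gen_field S (D y).
Proof.
move=> derD h y; have [srG iG] := subfield_gen S.
elim=> {y} [a /h //||a b _ ha _ hb|a _ ha|a b ga ha gb hb|a ga ha].
- by rewrite der1 //; exact: sr0.
- by rewrite der_add //; exact: srD.
- by rewrite der_opp //; exact: srN.
- by rewrite der_mul //; apply: srD => //; exact: srM.
- rewrite der_inv //; apply: srM => //; first exact: srN.
  by apply: iG; rewrite expr2; apply: srM.
Qed.

Lemma horner_der (D : K -> K) (p : {poly K}) t : derivation D ->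
  D p.[t] = (map_poly D p).[t] + p^`().[t] * D t.
Proof.
move=> derD; elim/poly_ind: p => [|p c IH].
  by rewrite horner0 deriv0 map_poly0 !horner0 mul0r addr0 der0.
have -> : map_poly D (p * 'X + c%:P) = map_poly D p * 'X + (D c)%:P.
  apply/polyP => i; rewrite coef_map_der // !coefD !coefMX !coefC.
  by case: i => [|i] /=; rewrite ?add0r // !addr0 coef_map_der.
rewrite derivMXaddC !hornerE der_add // der_mul // IH; ring.
Qed.

End GenField.

Section Adjoin.
Variables (K : fieldType) (F : K -> Prop) (t : K).
Hypothesis sfF : subfield_pred F.
Let srF := sf_ring sfF.
Let srP := subring_coefs_in srF.

Lemma gen_adjoin_ratio y : gen_field (adjoin F t) y ->
  exists g h, [/\ coefs_in F g, coefs_in F h, h.[t] != 0 & y = g.[t] / h.[t]].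
Proof.
pose G y := exists g h, [/\ coefs_in F g, coefs_in F h, h.[t] != 0 & y = g.[t] / h.[t]].
have poly_G g : coefs_in F g -> G g.[t].
  move=> hg; exists g, 1; split=> //; first exact: (sr1 srP).
    by rewrite hornerC oner_eq0.
  by rewrite hornerC divr1.
apply: (gen_field_min (F := G)); last first.
  move=> s [Fs|->]; first by rewrite -(hornerC s t); apply: poly_G; apply: coefs_inC.
  by rewrite -{1}(hornerX t); apply: poly_G; apply: coefs_inX.
split; first split.
- by rewrite -(hornerC 1 t); apply: poly_G; apply: (sr1 srP).
- move=> a b [g [h [hg hh h0 ->]]] [g' [h' [hg' hh' h0' ->]]].
  exists (g * h' + g' * h), (h * h'); split.
  + by apply: (srD srP) => //; apply: (srM srP).
  + exact: (srM srP).
  + by rewrite hornerM mulf_neq0.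
  + by rewrite hornerD !hornerM addf_div.
- move=> a [g [h [hg hh h0 ->]]]; exists (- g), h; split=> //; first exact: (srN srP).
  by rewrite hornerN mulNr.
- move=> a b [g [h [hg hh h0 ->]]] [g' [h' [hg' hh' h0' ->]]].
  exists (g * g'), (h * h'); split; try exact: (srM srP).
  + by rewrite hornerM mulf_neq0.
  + by rewrite !hornerM mulf_div.
- move=> a [g [h [hg hh h0 ->]]]; have [e|ne] := eqVneq g.[t] 0.
    rewrite e mul0r invr0; exists 0, 1; split; rewrite ?hornerC ?oner_eq0 ?mul0r //.
      exact: (sr0 srP).
    exact: (sr1 srP).
  by exists h, g; split=> //; rewrite invf_div.
Qed.

(** If the constant term [c] of [f] is nonzero, [y] times a polynomial in [y] equals [-c]; if it
    vanishes, [X] is divided out of [f]. *)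
Lemma inv_horner f y : f != 0 -> coefs_in F f -> f.[y] = 0 -> y != 0 ->
  exists2 h, coefs_in F h & y^-1 = h.[y].
Proof.
move=> + + + y0; elim/poly_ind: f => [|f c IH]; first by rewrite eqxx.
move=> n0 hf; rewrite !hornerE => r.
have hf' : coefs_in F f by move=> i; move: (hf i.+1); rewrite coefD coefMX coefC /= addr0.
have Fc : F c by move: (hf 0%N); rewrite coefD coefMX coefC /= add0r.
have [c0|c0] := eqVneq c 0.
  apply: IH => //; first by apply: contraNneq n0 => ->; rewrite c0 mul0r add0r.
  by apply/eqP; move/eqP: r; rewrite c0 addr0 mulf_eq0 (negPf y0) orbF.
exists (- c^-1 *: f).
  by apply: coefs_inZ => //; apply: (srN srF); apply: (sfV sfF).
rewrite hornerZ; apply: (mulfI y0); rewrite divff // mulrCA [y * _]mulrC.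
by rewrite (eqP (_ : f.[y] * y == - c)) ?mulrNN ?mulVf // -subr_eq0 opprK r.
Qed.

Hypothesis algt : alg_over F t.

(** Only inversion needs an argument: the norm of [X - a] is a polynomial over [F] that vanishes at
    [a], so [a^-1] is a polynomial in [a], hence in [t]. *)
Lemma gen_adjoin_poly y : gen_field (adjoin F t) y ->
  exists2 g, coefs_in F g & y = g.[t].
Proof.
apply: (gen_field_min (F := fun y => exists2 g, coefs_in F g & y = g.[t])); last first.
  move=> s [Fs|->]; first by exists s%:P; [apply: coefs_inC|rewrite hornerC].
  by exists 'X; [apply: coefs_inX|rewrite hornerX].
split; first split.
- by exists 1; [apply: (sr1 srP)|rewrite hornerC].
- by move=> a b [g hg ->] [h hh ->]; exists (g + h); [apply: (srD srP)|rewrite hornerD].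
- by move=> a [g hg ->]; exists (- g); [apply: (srN srP)|rewrite hornerN].
- by move=> a b [g hg ->] [h hh ->]; exists (g * h); [apply: (srM srP)|rewrite hornerM].
move=> a [g hg ea]; have [->|a0] := eqVneq a 0; first by exists 0; [apply: (sr0 srP)|rewrite invr0 horner0].
have [f [f0 hf]] : exists f, [/\ f != 0, coefs_in F f & 'X - a%:P %| f].
  apply: (alg_over_multiple srF (sfV sfF) algt (monicXsubC a)) => k.
  rewrite coefB coefX coefC; case: k => [|[|k]] /=.
  - by rewrite sub0r; exists (- g); [apply: (srN srP)|rewrite hornerN -ea].
  - by rewrite subr0; exists 1; [apply: (sr1 srP)|rewrite hornerC].
  - by rewrite subr0; exists 0; [apply: (sr0 srP)|rewrite horner0].
rewrite dvdp_XsubCl => /rootP r.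
have [h hh ->] := inv_horner f0 hf r a0.
by exists (h \Po g); [apply: coefs_in_comp|rewrite horner_comp -ea].
Qed.

End Adjoin.

Section AlgDer.
Variables (K : fieldType) (D : K -> K) (F : K -> Prop) (t : K).
Hypothesis derD : derivation D.
Hypothesis char0 : forall n : nat, n.+1%:R != 0 :> K.
Hypothesis sfF : subfield_pred F.
Hypothesis DF : forall a, F a -> F (D a).

(** An annihilating polynomial [p] is replaced by its [X]-derivative as long as that also kills [t];
    then the derivative of [p(t) = 0] can be solved for [D t]. *)
Lemma alg_over_der : alg_over F t -> gen_field (adjoin F t) (D t).
Proof.
have [sr iV] := subfield_gen (adjoin F t).
have ev p : coefs_in F p -> gen_field (adjoin F t) p.[t].
  move=> hp; apply: sr_horner => //; first by apply: gen_in; right.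
  by move=> i; apply: gen_in; left; apply: hp.
case=> p [p0 hp rt]; have [k] := ubnP (size p); elim: k => // k IH in p p0 hp rt *.
move=> sz; have hp' : coefs_in F p^`() by apply: coefs_in_deriv => //; case: sfF.
have [r|nr] := eqVneq p^`().[t] 0.
  have p1 : (1 < size p)%N.
    rewrite ltnNge; apply/negP => /size1_polyC e; move: rt p0.
    by rewrite e hornerC => ->; rewrite eqxx.
  apply: (IH p^`()) => //; last by rewrite -ltnS (leq_trans _ sz) // ltnS lt_size_deriv.
  apply/eqP => /polyP/(_ (size p).-2); rewrite coef_deriv coef0 => /eqP.
  rewrite prednK; last by rewrite -ltnS prednK // ltnW.
  rewrite -mulr_natl mulf_eq0 -/(lead_coef p) lead_coef_eq0 (negPf p0) orbF.
  by case: (size p) p1 => [|[|m]] //= _; rewrite (negPf (char0 m)).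
have := horner_der p t derD; rewrite rt der0 // => e.
have -> : D t = - ((map_poly D p).[t]) / p^`().[t].
  by apply: (mulIf nr); rewrite divfK // mulrC; apply/eqP; rewrite -addr_eq0 addrC -e.
apply: srM => //; last by apply: iV; apply: ev.
apply: srN => //; apply: ev => i; rewrite coef_map_der //; exact: DF.
Qed.
End AlgDer.

(** * Descent along a Liouvillian tower *)

Section Descent.
Variables (K : fieldType) (D : K -> K) (V : K).
Hypothesis derD : derivation D.
Hypothesis char0 : forall n : nat, n.+1%:R != 0 :> K.
Let del := riccati_der D V.
Let derdel : derivation del := derivation_riccati derD V.

(* The cofactor is forced by the top coefficients of a monic [P]. *)
Definition darboux_over (F : K -> Prop) : Prop := exists m P,
  [/\ P \is monic, size P = m.+2, coefs_in F P &
      del P = ((P`_m)%:P - m.+1%:R *: 'X) * P].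

Lemma coefs_in_riccati F P : subfield_pred F -> (forall a, F a -> F (D a)) -> F V ->
  coefs_in F P -> coefs_in F (del P).
Proof.
move=> [srF _] DF FV hP; have srP := subring_coefs_in srF.
apply: (srD srP); first by move=> i; rewrite coef_map_der //; apply: DF.
apply: (srM srP); last exact: coefs_in_deriv.
by apply: (srB srP); [apply: coefs_inC|apply: coefs_inXn].
Qed.

(** The cofactor is the one for which the coefficients of [X^(m+2)] and [X^(m+1)] both cancel. *)
Lemma size_riccati_sub m (f : {poly K}) : f \is monic -> size f = m.+2 ->
  (size (del f - ((f`_m)%:P - m.+1%:R *: 'X) * f)%R < m.+2)%N.
Proof.
move=> mf sf; have f1 : f`_m.+1 = 1 by have := monicP mf; rewrite /lead_coef sf.
have f0 j : (m.+2 <= j)%N -> f`_j = 0 by move=> h; rewrite nth_default ?sf.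
rewrite ltnS; apply/leq_sizeP => -[//|j]; rewrite ltnS => mj.
rewrite coefB /del coef_riccatiS // mulrBl coefB coefCM -scalerAl coefZ coefXM /=.
rewrite (f0 j.+2) //.
rewrite mul0rn mulr0 addr0.
move: mj; rewrite leq_eqVlt => /orP[/eqP <-|mj].
  by rewrite f1 der1 // mulr1 -mulr_natl -natr1; ring.
move: mj; rewrite leq_eqVlt => /orP[/eqP <-|mj].
  by rewrite f1 (f0 m.+2) // der0 // mulr0 mulr1; ring.
by rewrite (f0 j mj) (f0 j.+1 (leqW mj)) der0 // mul0rn !mulr0 !subrr.
Qed.

(** Descent on the degree of [f], made monic: subtracting the forced multiple of [f] from [del f]
    leaves a multiple of [Q] over [F] of smaller degree. When it is zero, [f] is Darboux. *)
Lemma darboux_of_multiple F (Q f : {poly K}) : subfield_pred F -> (forall a, F a -> F (D a)) -> F V ->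
  (1 < size Q)%N -> Q %| del Q -> f != 0 -> coefs_in F f -> Q %| f -> darboux_over F.
Proof.
move=> sfF DF FV sQ dQ; have [k] := ubnP (size f); elim: k f => // k IH f sz f0 hf Qf.
have [srF iF] := sfF; have srP := subring_coefs_in srF.
pose f1 := (lead_coef f)^-1 *: f.
have lf0 : (lead_coef f)^-1 != 0 by rewrite invr_eq0 lead_coef_eq0.
have mf1 : f1 \is monic by rewrite monicE lead_coefZ mulVf // -invr_eq0.
have hf1 : coefs_in F f1 by apply: coefs_inZ => //; apply: iF; apply: hf.
have Qf1 : Q %| f1 by rewrite dvdpZr.
pose m := (size f).-2.
have sf1 : size f1 = m.+2.
  rewrite size_scale // /m; have := leq_trans sQ (dvdp_leq f0 Qf).
  by case: (size f) => [|[]].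
pose g := del f1 - ((f1`_m)%:P - m.+1%:R *: 'X) * f1.
have sg : (size g < size f)%N by rewrite -(size_scale f lf0) -/f1 sf1 size_riccati_sub.
have [g0|g0] := eqVneq g 0.
  by exists m, f1; split=> //; apply/eqP; rewrite -subr_eq0 -/g g0.
apply: (IH g) => //; first by rewrite (leq_trans sg) // -ltnS.
  apply: (srB srP); first exact: coefs_in_riccati.
  apply: (srM srP) => //; apply: (srB srP); first exact: coefs_inC.
  apply: coefs_inZ => //; last exact: coefs_inX.
  by apply: sr_natmul => //; apply: sr1.
rewrite dvdp_sub // ?dvdp_mull //.
have /dvdpP[q ->] := Qf1; rewrite (der_mul derdel) dvdp_add ?dvdp_mull //.
Qed.

Lemma darboux_alg F t : subfield_pred F -> (forall a, F a -> F (D a)) -> F V ->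
  alg_over F t -> darboux_over (gen_field (adjoin F t)) -> darboux_over F.
Proof.
move=> sfF DF FV algt [m [P [mP sP hP eP]]]; have [srF iF] := sfF.
have [f [f0 hf Pf]] : exists f, [/\ f != 0, coefs_in F f & P %| f].
  by apply: (alg_over_multiple srF iF algt mP) => k; apply: gen_adjoin_poly.
by apply: (darboux_of_multiple (Q := P) (f := f)) => //; rewrite ?sP // eP dvdp_mull.
Qed.

(** In [H] the outer variable stands for [t] and the inner one for [X], so [lead_coef H] is the
    leading coefficient in [t]. *)
Lemma clear_denominators F t (Q : {poly K}) : subfield_pred F ->
  coefs_in (gen_field (adjoin F t)) Q ->
  exists (H : {poly {poly K}}) (h : {poly K}),
    [/\ coefs_in (coefs_in F) H, coefs_in F h, h.[t] != 0 & H.[t%:P] = h.[t] *: Q].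
Proof.
move=> sfF; have [srF iF] := sfF; have srP := subring_coefs_in srF.
have srPP := subring_coefs_in srP.
elim/poly_ind: Q => [|Q c IH] hQ.
  exists 0, 1; split; [exact: (sr0 srPP)|exact: (sr1 srP)| |].
    by rewrite hornerC oner_eq0.
  by rewrite horner0 scaler0.
have [|H [h [hH hh h0 e]]] := IH.
  by move=> i; move: (hQ i.+1); rewrite coefD coefMX coefC /= addr0.
have : gen_field (adjoin F t) c by move: (hQ 0%N); rewrite coefD coefMX coefC /= add0r.
case/(gen_adjoin_ratio sfF) => a [b [ha hb b0 ec]].
have liftH p : coefs_in F p -> coefs_in (coefs_in F) (map_poly polyC p).
  by move=> hp i; rewrite coef_map /=; apply: coefs_inC.
have evl p : (map_poly polyC p).[t%:P] = p.[t]%:P by rewrite horner_map.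
exists (H * map_poly polyC b * 'X%:P + map_poly polyC (a * h)), (b * h); split.
- apply: (srD srPP); last by apply: liftH; apply: (srM srP).
  apply: (srM srPP); first by apply: (srM srPP) => //; apply: liftH.
  by apply: (coefs_inC srP); apply: (coefs_inX srF).
- exact: (srM srP).
- by rewrite hornerM mulf_neq0.
- rewrite hornerD !hornerM hornerC !evl e ec -!mul_polyC !hornerM !polyCM mulrDr.
  have -> : (b.[t])%:P * (h.[t])%:P * (a.[t]%:P * (b.[t]^-1)%:P) =
      (b.[t])%:P * (b.[t]^-1)%:P * (a.[t]%:P * h.[t]%:P) by ring.
  by rewrite -(polyCM b.[t] b.[t]^-1) divff // mul1r; ring.
Qed.

(* Over [F(t)] with [t] transcendental and [t' = tau(t)], [deg tau <= 1], the derivation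
   does not raise the degree in [t], so the leading [t]-coefficient is again Darboux. *)
Lemma darboux_trans F t tau : subfield_pred F -> (forall a, F a -> F (D a)) -> F V ->
  ~ alg_over F t -> coefs_in F tau -> (size tau <= 2)%N -> D t = tau.[t] ->
  darboux_over (gen_field (adjoin F t)) -> darboux_over F.
Proof.
move=> sfF DF FV trt htau stau Dt [m [P [mP sP hP eP]]].
have [srF iF] := sfF; have srP := subring_coefs_in srF; have srPP := subring_coefs_in srP.
have [srG iG] := subfield_gen (adjoin F t).
(* Transcendence of [t], applied to each coefficient in [X] separately. *)
have trans2 (G : {poly {poly K}}) : coefs_in (coefs_in F) G -> G.[t%:P] = 0 -> G = 0.
  move=> hG e; apply/polyP => j; apply/polyP => i; rewrite !coef0.
  pose g := \poly_(j < size G) G`_j`_i.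
  have -> : G`_j`_i = g`_j.
    by rewrite coef_poly; case: ltnP => // h; rewrite (nth_default 0 h) coef0.
  suff -> : g = 0 by rewrite coef0.
  apply/eqP; apply: contra_notT trt => g0; exists g; split=> //.
    by move=> k; rewrite coef_poly; case: ifP => _; [apply: hG|apply: sr0].
  move/polyP/(_ i): e; rewrite coef0 horner_coef coef_sum => <-.
  rewrite horner_poly; apply: eq_bigr => k _.
  by rewrite -rmorphXn /= coefMC.
have [H [h [hH hh h0 eH]]] := clear_denominators sfF hP.
have [a [b [ha hb b0 eab]]] :
    exists a b, [/\ coefs_in F a, coefs_in F b, b.[t] != 0 & 
      D h.[t] / h.[t] + P`_m = a.[t] / b.[t]].
  apply: (gen_adjoin_ratio sfF); apply: (srD srG); last exact: hP.
  have hG : gen_field (adjoin F t) h.[t].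
    apply: (sr_horner srG); first by apply: gen_in; right.
    by move=> i; apply: gen_in; left; apply: hh.
  apply: (srM srG); last exact: iG.
  apply: (gen_field_der derD) => // s [Fs|->]; first by apply: gen_in; left; apply: DF.
  rewrite Dt; apply: (sr_horner srG); first by apply: gen_in; right.
  by move=> i; apply: gen_in; left; apply: htau.
pose lft := map_poly (@polyC K).
have liftH p : coefs_in F p -> coefs_in (coefs_in F) (lft p).
  by move=> hp i; rewrite coef_map /=; apply: coefs_inC.
have evl p : (lft p).[t%:P] = p.[t]%:P by rewrite horner_map.
(* The derivation lifted to two variables: [del] on the coefficients, and [t' = tau]. *)
pose dH := map_poly del H + lft tau * H^`().
have dHt : dH.[t%:P] = del H.[t%:P].
  rewrite /dH hornerD hornerM evl; clear -derD derdel Dt.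
  elim/poly_ind: H => [|H c IH].
    by rewrite horner0 deriv0 map_poly0 !horner0 mulr0 addr0 (der0 derdel).
  have -> : map_poly del (H * 'X + c%:P) = map_poly del H * 'X + (del c)%:P.
    apply/polyP => i; rewrite (coef_map_der derdel) !coefD !coefMX !coefC.
    by case: i => [|i] /=; rewrite ?add0r // !addr0 (coef_map_der derdel).
  rewrite derivMXaddC !hornerMXaddC hornerD hornerMX (der_add derdel) (der_mul derdel) -IH.
  have -> : del t%:P = (tau.[t])%:P by rewrite /del riccati_derC // Dt.
  by move: (del c) => d; ring.
(* The Darboux identity of [h(t) P], cleared of the denominator [b]; it holds at [t], hence
   identically. *)
have key : lft b * dH = (lft a - lft b * (m.+1%:R *: 'X)%:P) * H.
  apply/eqP; rewrite -subr_eq0; apply/eqP; apply: trans2.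
    have hdH : coefs_in (coefs_in F) dH.
      apply: (srD srPP); last first.
        by apply: (srM srPP); [apply: liftH|apply: (coefs_in_deriv srP)].
      by move=> i; rewrite (coef_map_der derdel); apply: coefs_in_riccati.
    apply: (srB srPP); apply: (srM srPP) => //; try exact: liftH.
    apply: (srB srPP); first exact: liftH.
    apply: (srM srPP); first exact: liftH.
    apply: (coefs_inC srP); apply: (coefs_inZ srF); last exact: coefs_inX.
    by apply: (sr_natmul srF); apply: (sr1 srF).
  rewrite hornerD hornerN !hornerM dHt hornerD hornerN hornerM hornerC !evl eH.
  rewrite -mul_polyC (der_mul derdel) eP {1}/del riccati_derC //.
  have -> : a.[t] = (D h.[t] / h.[t] + P`_m) * b.[t] by rewrite eab divfK.
  have -> : (D h.[t])%:P = (D h.[t] / h.[t])%:P * (h.[t])%:P by rewrite -polyCM divfK.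
  move: (D h.[t] / h.[t]) (m.+1%:R *: 'X) => w z.
  by rewrite !polyCM polyCD; ring.
have H0 : H != 0.
  apply/eqP => e; move: eH; rewrite e horner0 => /esym/eqP; rewrite scaler_eq0 (negPf h0) /=.
  by rewrite -size_poly_eq0 sP.
pose L := lead_coef H; have L0 : L != 0 by rewrite lead_coef_eq0.
pose N := (size H).-1; have sH : size H = N.+1 by rewrite /N prednK // size_poly_gt0.
have bn0 : b != 0 by apply: contraNneq b0 => ->; rewrite horner0.
pose s := (size b).-1; have sb : size b = s.+1 by rewrite /s prednK // size_poly_gt0.
have dHN : dH`_N = del L + (tau`_1 *+ N) *: L.
  rewrite coefD (coef_map_der derdel) -/(lead_coef H) -/L; congr (_ + _).
  have -> : lft tau = (tau`_1)%:P%:P * 'X + (tau`_0)%:P%:P.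
    apply/polyP => i; rewrite coefD coefMX !coefC coef_map.
    case: i => [|[|i]] /=; rewrite ?add0r ?addr0 //.
    by rewrite nth_default // (leq_trans stau).
  have H'N : H^`()`_N = 0 by rewrite coef_deriv nth_default ?sH // mul0rn.
  rewrite mulrDl coefD [X in _ + X]coefCM H'N mulr0 addr0.
  rewrite -mulrA coefCM coefXM coef_deriv; case: (posnP N) => [->|N0] /=.
    by rewrite mulr0 mulr0n scale0r.
  by rewrite prednK // -/(lead_coef H) -/L -mul_polyC polyCMn mulrnAl mulrnAr.
have dHs : (size dH <= N.+1)%N.
  apply/leq_sizeP => j hj; rewrite coefD (coef_map_der derdel) nth_default ?sH //.
  rewrite (der0 derdel) add0r nth_default //.
  have [->|H'0] := eqVneq H^`() 0; first by rewrite mulr0 size_poly0.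
  apply: leq_trans (size_polyMleq _ _) _.
  apply: leq_trans hj; rewrite -ltnS prednK; last by rewrite addn_gt0 !size_poly_gt0 H'0 orbT.
  have : (size H^`() < size H)%N by apply: lt_size_deriv.
  rewrite sH ltnS => hH'; rewrite -[N.+2]/(2 + N)%N; apply: leq_add => //.
  by apply: leq_trans (size_poly _ _) stau.
have slb : size (lft b) = s.+1 by rewrite size_map_polyC.
have lbs : (lft b)`_s = (lead_coef b)%:P by rewrite coef_map.
have lb0 : lead_coef b != 0 by rewrite lead_coef_eq0.
(* Otherwise the coefficient of [t^(r + N)], with [r = deg a], would be zero on the left of [key]
   and nonzero on the right. *)
have sab : (size a <= s.+1)%N.
  rewrite leqNgt; apply/negP => sa.
  pose r := (size a).-1; have sar : size a = r.+1 by rewrite /r prednK // (leq_trans _ sa).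
  have sr : (s < r)%N by rewrite -ltnS -sar.
  move/polyP/(_ (r + N)%N): key.
  rewrite [LHS]nth_default; last first.
    apply: leq_trans (size_polyMleq _ _) _; rewrite slb.
    by rewrite addSn /= (leq_trans (leq_add (leqnn s) dHs)) // addnS -addSn leq_add2r.
  rewrite coefM_top ?sH //; last first.
    apply/leq_sizeP => j hj; rewrite coefB [X in X - _]nth_default ?sub0r; last by rewrite size_map_polyC sar.
    by rewrite coefMC nth_default ?mul0r ?oppr0 // slb (leq_trans _ hj) // ltnS ltnW.
  rewrite coefB coefMC [X in _ - X * _]nth_default ?slb // mul0r subr0 coef_map /=.
  move/esym/eqP; rewrite mulf_eq0 -/L (negPf L0) orbF polyC_eq0 -/(lead_coef a).
  by rewrite lead_coef_eq0 -size_poly_eq0 sar.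
have keyN : (lead_coef b)%:P * (del L + (tau`_1 *+ N) *: L) =
    ((a`_s)%:P - (lead_coef b)%:P * (m.+1%:R *: 'X)) * L.
  move/polyP/(_ (s + N)%N): key; rewrite !coefM_top ?slb ?sH //.
    by rewrite dHN coefB coefMC lbs coef_map.
  apply/leq_sizeP => j hj; rewrite coefB coefMC !nth_default ?mul0r ?subrr // ?slb //.
  by rewrite size_map_polyC (leq_trans sab).
(* The ratio of top coefficients, minus the contribution [N tau_1] of differentiating [t^N]. *)
pose al := a`_s / lead_coef b - tau`_1 *+ N.
have eL : del L = (al%:P - m.+1%:R *: 'X) * L.
  have lbP : (lead_coef b)%:P != 0 by rewrite polyC_eq0.
  apply: (mulfI lbP); apply: (addIr ((lead_coef b)%:P * (tau`_1 *+ N *: L))).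
  rewrite -mulrDr keyN /al polyCB polyCM -[_ *: L]mul_polyC.
  have ea : (a`_s)%:P = (lead_coef b)%:P * ((a`_s)%:P * (lead_coef b)^-1%:P).
    by rewrite mulrCA -polyCM divff // mulr1.
  rewrite [in LHS]ea; move: (_ * _^-1%:P) (m.+1%:R *: 'X) => c z; ring.
apply: (darboux_of_multiple (Q := L) (f := L)) => //; last exact: hH.
(* A constant [L] is excluded by the term [-(m+1) X] of its cofactor. *)
- rewrite ltnNge; apply/negP => /size1_polyC e.
  move: eL L0; rewrite e /del riccati_derC // => /polyP/(_ 1%N).
  rewrite coefC /= coefMC coefB coefC /= sub0r coefZ coefX mulr1 => /esym/eqP.
  by rewrite mulf_eq0 oppr_eq0 (negPf (char0 m)) /= => /eqP ->; rewrite eqxx.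
- by rewrite eL dvdp_mull.
Qed.

(** A transcendental [t] rules out the first kind of step; the other two give [t' = tau(t)] with
    [tau] constant or a multiple of [t]. *)
Lemma darboux_step F t : subfield_pred F -> (forall a, F a -> F (D a)) -> F V ->
  liouville_step D F t -> darboux_over (gen_field (adjoin F t)) -> darboux_over F.
Proof.
move=> sfF DF FV st dG; have [srF iF] := sfF.
have [algt|ntr] := classic (alg_over F t); first exact: darboux_alg dG.
case: st => [[p [p0 [hp /rootP rp]]]|[FDt|[t0 FDt]]].
- by case: ntr; exists p.
- apply: (darboux_trans sfF DF FV ntr (tau := (D t)%:P)) dG.
  + exact: coefs_inC.
  + by rewrite (leq_trans (size_polyC_leq1 _)).
  + by rewrite hornerC.
- apply: (darboux_trans sfF DF FV ntr (tau := (D t / t) *: 'X)) dG.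
  + by apply: coefs_inZ => //; apply: coefs_inX.
  + by rewrite (leq_trans (size_scale_leq _ _)) // size_polyX.
  + by rewrite hornerZ hornerX divfK.
Qed.

Lemma liouville_step_der F t : subfield_pred F -> (forall a, F a -> F (D a)) ->
  liouville_step D F t -> gen_field (adjoin F t) (D t).
Proof.
move=> sfF DF [[p [p0 [hp /rootP rp]]]|[FDt|[t0 FDt]]].
- by apply: alg_over_der => //; exists p.
- by apply: gen_in; left.
- by rewrite -(divfK t0 (D t)); apply: gen_mul; apply: gen_in; [left|right].
Qed.

End Descent.

Lemma derivation_deriv (R : comNzRingType) : derivation (@deriv R).
Proof. by split=> a b; [rewrite derivD|rewrite derivM]. Qed.

Lemma deriv_eq0 (R : idomainType) (p : {poly R}) : (forall n, n.+1%:R != 0 :> R) ->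
  p^`() = 0 -> p = (p`_0)%:P.
Proof.
move=> char0 h; apply/polyP => -[|i]; rewrite coefC //=.
move/polyP/(_ i)/eqP: h; rewrite coef_deriv coef0 -mulr_natl mulf_eq0 (negPf (char0 i)).
by move/eqP.
Qed.

(** * From the field [C(x)] to the ring [C[x]] *)

Section Eval.
Variables (C : numClosedFieldType) (K : fieldType) (ev : {rmorphism {poly C} -> K}).
Variables (D : K -> K) (F0 : K -> Prop).
Hypothesis derD : derivation D.
Hypothesis der_eval : forall p, D (ev p) = ev p^`().
Hypothesis eval_ratio : forall y, F0 y -> exists g h, ev h != 0 /\ y = ev g / ev h.

(** With [ev] as evaluation at [x], this is the transcendence of [x]: the kernel of [ev] is stable
    under derivation, which leads down to constants, where [ev] is injective. *)
Lemma eval_inj : injective ev.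
Proof.
suff ev0 p : ev p = 0 -> p = 0.
  by move=> p q /eqP; rewrite -subr_eq0 -rmorphB => /eqP/ev0/eqP; rewrite subr_eq0 => /eqP.
have [k] := ubnP (size p); elim: k p => // k IH p sz e.
have [->//|p0] := eqVneq p 0.
have p'0 : p^`() = 0.
  apply: IH; first by rewrite (leq_trans (lt_size_deriv p0)).
  by rewrite -der_eval e der0.
have char0 m : m.+1%:R != 0 :> C by rewrite pnatr_eq0.
move: e; rewrite (deriv_eq0 char0 p'0) => /eqP; have [->//|c0] := eqVneq p`_0 0.
rewrite -[ev _]/((ev \o polyC) p`_0) fmorph_eq0 => /eqP -> //.
Qed.

Lemma riccati_eval V (H : {poly {poly C}}) :
  riccati_der D (ev V) (map_poly ev H) = map_poly ev (riccati_der (@deriv C) V H).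
Proof.
rewrite /riccati_der rmorphD rmorphM rmorphB /= map_polyC map_polyXn -deriv_map; congr (_ + _).
by apply/polyP => i; rewrite coef_map_der // !coef_map /= der_eval.
Qed.

Lemma clear_eval (Q : {poly K}) : coefs_in F0 Q ->
  exists H h, ev h != 0 /\ map_poly ev H = ev h *: Q.
Proof.
elim/poly_ind: Q => [|Q c IH] hQ; first by exists 0, 1; rewrite !rmorph1 oner_eq0 rmorph0 scaler0.
have [|H [h [h0 eH]]] := IH.
  by move=> i; move: (hQ i.+1); rewrite coefD coefMX coefC /= addr0.
have [|a [b [b0 ec]]] := @eval_ratio c.
  by move: (hQ 0%N); rewrite coefD coefMX coefC /= add0r.
exists (b *: H * 'X + (h * a)%:P), (b * h); split; first by rewrite rmorphM mulf_neq0.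
rewrite rmorphD [X in X + _ = _]rmorphM /= map_polyX map_polyC map_polyZ eH.
rewrite scalerDr scalerA -scalerAl; congr (_ + _); first by rewrite rmorphM.
rewrite -mul_polyC -polyCM; congr (_%:P); rewrite /= ec !rmorphM.
by field.
Qed.

(** On [{poly {poly C}}] the relation [%|] allows a nonzero factor from [{poly C}], that is, it
    means divisibility over the fractions; here the factor is [h * k]. *)
Lemma darboux_base V : darboux_over D (ev V) F0 ->
  exists P : {poly {poly C}}, (1 < size P)%N /\ P %| riccati_der (@deriv C) V P.
Proof.
case=> m [P [mP sP hP eP]]; have [H [h [h0 eH]]] := clear_eval hP.
have [g [k [k0 eg]]] := eval_ratio (hP m).
have sH : size H = m.+2.
  by rewrite -(size_map_inj_poly eval_inj (rmorph0 _)) eH size_scale.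
exists H; rewrite sH; split=> //; apply/Pdiv.Idomain.dvdpP.
exists (h * k, (h^`() * k + g * h)%:P - (m.+1%:R * (h * k)) *: 'X).
  by apply: contraNneq (mulf_neq0 h0 k0) => /= e; rewrite -rmorphM e rmorph0.
apply: (map_inj_poly eval_inj (rmorph0 _)) => /=.
rewrite map_polyZ [RHS]rmorphM [X in _ = X * _]rmorphB /= map_polyZ map_polyX map_polyC.
rewrite -riccati_eval eH.
rewrite -[_ *: P]mul_polyC (der_mul (derivation_riccati derD _)) eP riccati_derC // der_eval.
rewrite /= eg -!mul_polyC !rmorphD !rmorphM !rmorph_nat /=.
have ek : (ev k)%:P * ((ev k)^-1)%:P = 1 by rewrite -polyCM divff.
by move: ((ev k)^-1%:P) (m.+1%:R) ek => k' c ek; ring: ek.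
Qed.

End Eval.

Section Base.
Variables (C : numClosedFieldType) (K : fieldType) (iota : {rmorphism C -> K}) (x : K).

Lemma subfield_range : subfield_pred (fun y => exists c, y = iota c).
Proof.
split; first split.
- by exists 1; rewrite rmorph1.
- by move=> _ _ [a ->] [b ->]; exists (a + b); rewrite rmorphD.
- by move=> _ [a ->]; exists (- a); rewrite rmorphN.
- by move=> _ _ [a ->] [b ->]; exists (a * b); rewrite rmorphM.
- by move=> _ [a ->]; exists a^-1; rewrite fmorphV.
Qed.

Lemma tower_base_ratio ts y : gen_field (tower_gens iota x ts 0) y ->
  exists g h, (map_poly iota h).[x] != 0 /\ y = (map_poly iota g).[x] / (map_poly iota h).[x].
Proof.
have lift (p : {poly K}) : coefs_in (fun y => exists c, y = iota c) p ->
    exists q, p = map_poly iota q.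
  elim/poly_ind: p => [|p c IH] hp; first by exists 0; rewrite rmorph0.
  have [|q ->] := IH.
    by move=> i; move: (hp i.+1); rewrite coefD coefMX coefC /= addr0.
  have [c' ->] : exists c', c = iota c'.
    by move: (hp 0%N); rewrite coefD coefMX coefC /= add0r.
  by exists (q * 'X + c'%:P); rewrite rmorphD rmorphM /= map_polyX map_polyC.
move=> Fy; have : gen_field (adjoin (fun y => exists c, y = iota c) x) y.
  apply: gen_field_min Fy; first exact: subfield_gen.
  by move=> s [h|[->|[j []//]]]; apply: gen_in; [left|right].
case/(gen_adjoin_ratio subfield_range) => g [h [/lift[g' ->] /lift[h' ->] h0 ->]].
by exists g', h'.
Qed.

Lemma der_base D p : derivation D -> (forall c, D (iota c) = 0) -> D x = 1 ->
  D (map_poly iota p).[x] = (map_poly iota p^`()).[x].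
Proof.
move=> derD Di Dx; rewrite horner_der // Dx mulr1 deriv_map.
have -> : map_poly D (map_poly iota p) = 0; last by rewrite horner0 add0r.
by apply/polyP => i; rewrite coef_map_der // coef_map coef0 /= Di.
Qed.

End Base.

Lemma liouvillian_darboux (C : numClosedFieldType) (V : {poly C}) :
  has_liouvillian_solution V ->
  exists P : {poly {poly C}}, (1 < size P)%N /\ P %| riccati_der (@deriv C) V P.
Proof.
case=> K [iota [D [x [ts [psi [derD [Di [Dx [st [gpsi [psi0 epsi]]]]]]]]]]].
pose Vx := (map_poly iota V).[x].
have char0 (n : nat) : n.+1%:R != 0 :> K.
  by rewrite -(rmorph_nat iota) fmorph_eq0 pnatr_eq0.
pose F i := gen_field (tower_gens iota x ts i).
have sfF i : subfield_pred (F i) by exact: subfield_gen.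
have FV i : F i Vx.
  apply: (sr_horner (sf_ring (sfF i))); first by apply: gen_in; right; left.
  by move=> j; rewrite coef_map; apply: gen_in; left; exists V`_j.
have up i : forall y, gen_field (adjoin (F i) (nth 0 ts i)) y -> F i.+1 y.
  apply: gen_field_min => // s [|->]; last by apply: gen_in; right; right; exists i.
  apply: gen_field_min => // {}s [h|[h|[j [ji ->]]]]; apply: gen_in; [by left|by right; left|].
  by right; right; exists j; rewrite ltnS ltnW.
have dn i : forall y, F i.+1 y -> gen_field (adjoin (F i) (nth 0 ts i)) y.
  apply: gen_field_min => [|s [h|[h|[j []]]]]; first exact: subfield_gen.
  - by apply: gen_in; left; apply: gen_in; left.
  - by apply: gen_in; left; apply: gen_in; right; left.
  rewrite ltnS leq_eqVlt => /orP[/eqP ->|ji] ->; apply: gen_in; first by right.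
  by left; apply: gen_in; right; right; exists j.
have DF i : (i <= size ts)%N -> forall a, F i a -> F i (D a).
  elim: i => [|i IH] hi.
    apply: (gen_field_der derD) => s [[c ->]|[->|[j []//]]].
    - by rewrite Di; apply: (sr0 (sf_ring (sfF 0%N))).
    - by rewrite Dx; apply: gen_one.
  move=> a /dn ga; apply: up; apply: (gen_field_der derD) ga => s [Fs|->].
    by apply: gen_in; left; apply: IH => //; apply: ltnW.
  by apply: liouville_step_der => //; [apply: IH; apply: ltnW|apply: st].
have dtop : darboux_over D Vx (F (size ts)).
  (* [u] solves the Riccati equation [u' = V - u^2], so [del Q = V - X^2 - u' = -(X + u) Q]. *)
  pose u := D psi / psi; pose Q := 'X - u%:P.
  have Fu : F (size ts) u by apply: gen_mul; [apply: DF|apply: gen_inv].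
  have hQ : coefs_in (F (size ts)) Q.
    have [srF _] := sfF (size ts); have srP := subring_coefs_in srF.
    by apply: (srB srP); [apply: (coefs_inX srF)|apply: (coefs_inC srF)].
  apply: (darboux_of_multiple derD (sfF _) (DF _ _) (FV _) (Q := Q) (f := Q)) => //.
  - by rewrite size_XsubC.
  - rewrite (der_sub (derivation_riccati derD _)) riccati_derC //.
    have -> : D u = Vx - u ^+ 2.
      by rewrite /u (der_mul derD) epsi (der_inv _ derD) -/Vx; field.
    have -> : riccati_der D Vx 'X = Vx%:P - 'X^2.
      rewrite /riccati_der derivX mulr1; have -> : map_poly D 'X = 0; last by rewrite add0r.
      apply/polyP => i; rewrite coef_map_der // coefX coef0.
      by case: (i == 1%N); rewrite ?der0 // -[true%:R]/(1 : K) der1.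
    have -> : Vx%:P - 'X^2 - (Vx - u ^+ 2)%:P = - ('X + u%:P) * Q.
      by rewrite /Q polyCB rmorphXn /=; ring.
    exact: dvdp_mull.
  - by rewrite polyXsubC_eq0.
have d0 : darboux_over D Vx (F 0%N).
  suff gen i : (i <= size ts)%N -> darboux_over D Vx (F i) -> darboux_over D Vx (F 0%N).
    exact: gen dtop.
  elim: i => // i IH hi [m [P [h1 h2 h3 h4]]].
  apply: IH; first exact: ltnW.
  apply: (darboux_step derD char0 (sfF i) (DF i (ltnW hi)) (FV i) (st i hi)).
  by exists m, P; split=> // j; apply: dn; apply: h3.
pose ev : {rmorphism {poly C} -> K} := horner_eval x \o map_poly iota.
apply: (darboux_base (ev := ev) derD _ _ d0) => [p|y]; first exact: der_base.
exact: tower_base_ratio.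
Qed.

(** * Darboux polynomials over C[x] *)

Section FirstIntegral.
Variables (C : numFieldType) (n : nat) (V : {poly C}).
Hypothesis n0 : (0 < n)%N.
Hypothesis monV : V \is monic.
Hypothesis sizeV : size V = (2 * n).+1.

(* The odd-indexed terms behave like the coefficients of [(X^2 - x^(2n))^(m/2)]; up to this
   alternating sign, all contributions to a leading coefficient are positive. *)
Lemma recurrence_neq0 m (g : nat -> {poly C}) : (0 < m)%N -> g 0%N = 0 -> g 1%N != 0 ->
  (forall e, (e <= m)%N ->
     e.+1%:R *: g e.+2 = - (g e.+1)^`() - (m - e).+1%:R *: (V * g e)) ->
  g m.+2 != 0.
Proof.
move=> m0 g0 g1 rec; pose N := (size (g 1%N)).-1; pose lc := lead_coef (g 1%N).
have lc0 : lc != 0 by rewrite lead_coef_eq0.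
have sg1 : size (g 1%N) = N.+1 by rewrite /N prednK // size_poly_gt0.
(* Two steps of the recurrence multiply by [V], of degree [2 n], so [d s] is the expected degree of
   [g (2 s + 1)]. *)
pose d s := (2 * n * s + N)%N.
have dS s : d s.+1 = (2 * n + d s)%N by rewrite /d mulnS addnA.
have V1 : V`_(2 * n) = 1 by have := monicP monV; rewrite /lead_coef sizeV.
pose evenP s := (size (g (2 * s).+1) <= (d s).+1)%N /\
  exists2 a, 0 < a & (g (2 * s).+1)`_(d s) = (-1) ^+ s * a * lc.
(* Here the expected degree is [d s - 1]; the factor ['X] avoids the subtraction at [d s = 0].
   Positivity is asked only for [0 < s], because [g 2 = -(g 1)'] may vanish. *)
pose oddP s := (size ('X * g (2 * s).+2)%R <= (d s).+1)%N /\
  exists2 b, 0 <= b /\ ((0 < s)%N -> 0 < b) &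
    ('X * g (2 * s).+2)`_(d s) = (-1) ^+ s.+1 * b * lc.
have szX (p : {poly C}) k : (size ('X * p)%R <= k.+1)%N -> (size p <= k)%N.
  have [->|p0] := eqVneq p 0; first by rewrite size_poly0.
  by rewrite mulrC size_mulX.
have oddstep s : (2 * s <= m)%N -> (0 < d s)%N || (s == 0)%N -> evenP s ->
    (s != 0%N -> oddP s.-1) -> oddP s.
  move=> hs ds [sz [a a0 ea]] ho.
  have r := rec _ hs; have nz : ((2 * s).+1)%:R != 0 :> C by rewrite pnatr_eq0.
  have eX : (2 * s).+1%:R *: ('X * g (2 * s).+2) =
     - ('X * (g (2 * s).+1)^`()) - (m - 2 * s).+1%:R *: (V * ('X * g (2 * s)%N)).
    by rewrite [LHS]scalerAr r mulrBr mulrN -scalerAr; congr (_ - _ *: _); rewrite mulrCA.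
  have sz1 : (size ('X * (g (2 * s).+1)^`())%R <= (d s).+1)%N.
    apply/leq_sizeP => j hj; rewrite coefXM; case: j hj => //= j hj.
    by rewrite coef_deriv nth_default ?mul0rn // (leq_trans sz).
  have c1 : ('X * (g (2 * s).+1)^`())`_(d s) = (g (2 * s).+1)`_(d s) *+ d s.
    by rewrite coefXM coef_deriv; case: (d s).
  have [sz2 [b b0 c2]] : (size (V * ('X * g (2 * s)%N))%R <= (d s).+1)%N /\
     exists2 b, 0 <= b & (V * ('X * g (2 * s)%N))`_(d s) = (-1) ^+ s * b * lc.
    case: s {r nz eX sz1 c1 ds sz a a0 ea hs} ho => [_|s /(_ isT) [sz [b [b0 _] eb]]].
      by rewrite muln0 g0 !mulr0 size_poly0; split=> //; exists 0 => //; rewrite coef0 mulr0 mul0r.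
    rewrite dS mulnS; split; first by apply: size_le_mul => //; rewrite sizeV.
    by exists b => //; rewrite coefM_top ?sizeV // V1 mul1r eb.
  split.
    rewrite -(size_scale _ nz) eX (leq_trans (size_polyD _ _)) // geq_max !size_polyN sz1 /=.
    by rewrite (leq_trans (size_scale_leq _ _)).
  exists (((d s)%:R * a + (m - 2 * s).+1%:R * b) / (2 * s).+1%:R).
    have h1 : 0 <= (m - 2 * s).+1%:R * b by rewrite mulr_ge0.
    split=> [|s0]; first by rewrite divr_ge0 // addr_ge0 // mulr_ge0 // ltW.
    rewrite divr_gt0 ?ltr0n // ltr_wpDr // mulr_gt0 // ltr0n.
    by case: s s0 ds {hs sz ea ho r nz eX sz1 c1 c2 h1 sz2} => // s _; rewrite orbF.
  apply: (mulfI nz); rewrite -coefZ eX coefB coefN coefZ c1 c2 ea exprS.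
  rewrite -[_ *+ d s]mulr_natl.
  move: ((2 * s).+1%:R) ((-1) ^+ s) ((d s)%:R) ((m - _).+1%:R) nz => c u v w nz; field.
  exact: nz.
have evenstep s : (2 * s < m)%N -> evenP s -> oddP s -> evenP s.+1.
  move=> hs [sz [a a0 ea]] [szo _]; have r := rec (2 * s).+1 hs.
  have nz : ((2 * s).+2)%:R != 0 :> C by rewrite pnatr_eq0.
  have sz1 : (size (g (2 * s).+2)^`() <= d s)%N.
    apply/leq_sizeP => j hj; rewrite coef_deriv nth_default ?mul0rn //.
    by apply: leq_trans (szX _ _ szo) _; apply: leqW.
  rewrite /evenP mulnS -[(2 + 2 * s).+1]/((2 * s).+3) dS; split.
    rewrite -(size_scale _ nz) r (leq_trans (size_polyD _ _)) // geq_max !size_polyN.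
    apply/andP; split; first by rewrite (leq_trans sz1) // leqW // leq_addl.
    by apply: leq_trans (size_scale_leq _ _) _; apply: size_le_mul; rewrite ?sizeV.
  exists ((m - (2 * s).+1).+1%:R * a / (2 * s).+2%:R).
    by rewrite divr_gt0 ?mulr_gt0 ?ltr0n.
  apply: (mulfI nz); rewrite -coefZ r coefB coefN coefZ [X in - X]nth_default; last first.
    by rewrite (leq_trans sz1) ?leq_addl.
  rewrite coefM_top ?sizeV // V1 ea exprS mul1r.
  move: ((2 * s).+2%:R) ((-1) ^+ s) ((m - _).+1%:R) nz => c u v nz; field.
  exact: nz.
have main s : ((2 * s <= m.+1)%N -> evenP s) /\ ((2 * s <= m)%N -> oddP s).
  elim: s => [|s [IHe IHo]].
    have e0 : evenP 0%N.
      rewrite /evenP /d !muln0 add0n sg1; split=> //; exists 1; first exact: ltr01.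
      by rewrite expr0 !mul1r /lc /lead_coef sg1.
    by split=> // _; apply: oddstep => //; rewrite orbT.
  have e1 : (2 * s.+1 <= m.+1)%N -> evenP s.+1.
    rewrite mulnS => hs; apply: evenstep => //.
      by apply: IHe; apply: leq_trans hs; rewrite leq_addl.
    by apply: IHo; apply: ltnW.
  split=> // hs; apply: oddstep => //.
  - by rewrite dS addn_gt0 muln_gt0 n0.
  - by apply: e1; apply: leqW.
  - by move=> _; apply: IHo; apply: leq_trans hs; rewrite mulnS leq_addl.
(* The parity of [m] decides whether [g (m+2)] falls under [evenP] or [oddP]; in the latter case
   [0 < m] provides positivity. *)
have me : m = (odd m + 2 * m./2)%N by rewrite mul2n odd_double_half.
case om: (odd m) in me.
  have ms : (2 * (m./2).+1 = m.+1)%N by rewrite mulnS {2}me add1n.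
  have [h _] := main (m./2).+1; have [_ [a a0]] : evenP (m./2).+1 by apply: h; rewrite ms.
  rewrite ms => ea; apply/eqP => e; move: ea; rewrite e coef0 => /esym/eqP.
  by rewrite !mulf_eq0 signr_eq0 (negPf lc0) gt_eqF.
have ms : (2 * m./2 = m)%N by rewrite {2}me add0n.
have [_ h] := main m./2; have [_ [b [_ b0]]] : oddP m./2 by apply: h; rewrite ms.
rewrite ms => eb; apply/eqP => e; move: eb; rewrite e mulr0 coef0 => /esym/eqP.
rewrite !mulf_eq0 signr_eq0 (negPf lc0) gt_eqF // b0 //.
by move: m0; rewrite -{1}ms muln_gt0.
Qed.
End FirstIntegral.

(** * Squarefree and primitive Darboux polynomials *)

Section Riccati.
Variables (C : numClosedFieldType) (V : {poly C}).
Let del := riccati_der (@deriv C) V.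
Let derd := derivation_deriv C.
Let derdel : derivation del := derivation_riccati derd V.
Implicit Types P Q : {poly {poly C}}.

Lemma riccatiZ c P : del (c *: P) = c^`() *: P + c *: del P.
Proof. by rewrite -!mul_polyC (der_mul derdel) {1}/del riccati_derC. Qed.

(** [G] divides [del P], and also [del P'] by the commutator [riccati_der_deriv]; applying [del] to
    a Bezout relation for [G] concludes, up to factors in [C[x]]. *)
Lemma gcdp_darboux P : P %| del P -> gcdp P P^`() %| del (gcdp P P^`()).
Proof.
move=> dP; set G := gcdp _ _.
have GP : G %| P by apply: dvdp_gcdl.
have GP' : G %| P^`() by apply: dvdp_gcdr.
have GdP : G %| del P by apply: dvdp_trans dP.
have GdP' : G %| del P^`().
  have /Pdiv.Idomain.dvdpP[[c q] /= c0 e] := dP.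
  rewrite -(dvdpZr _ _ c0) /del riccati_der_deriv // scalerDr.
  rewrite -derivZ e derivM !dvdp_add ?dvdp_mull // dvdpZr // dvdp_mull //.
have [[u v] /= /eqpP[[c1 c2] /= /andP[c10 c20] e]] := Bezoutp P P^`().
have : G %| del (c2 *: G).
  rewrite -e riccatiZ (der_add derdel) !(der_mul derdel) -!mul_polyC.
  by rewrite dvdp_add // dvdp_mull // !dvdp_add ?dvdp_mull.
rewrite riccatiZ dvdp_addr; last by rewrite -mul_polyC dvdp_mull.
by rewrite (dvdpZr _ _ c20).
Qed.

Lemma divide_linear P r : (forall i, root P`_i r) -> exists Q, P = ('X - r%:P) *: Q.
Proof.
move=> h; exists (map_poly (fun p => p %/ ('X - r%:P)) P); apply/polyP => i.
by rewrite coefZ coef_map_id0 ?div0p // mulrC divpK // dvdp_XsubCl.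
Qed.

(** As [C] is algebraically closed, this says that the coefficients of [P] have no nonconstant
    common factor in [C[x]]. *)
Definition primitive_x P : Prop := forall r, exists i, ~~ root P`_i r.

Lemma primitive_part P : P != 0 -> exists g Q, [/\ g != 0, P = g *: Q & primitive_x Q].
Proof.
have [k] := ubnP (size (lead_coef P)); elim: k P => // k IH P sz P0.
have [[r hr]|pr] := classic (exists r, forall i, root P`_i r); last first.
  exists 1, P; rewrite oner_eq0 scale1r; split=> // r.
  apply: NNPP => h; apply: pr; exists r => i; apply/negPn/negP => hi.
  by apply: h; exists i.
have [Q eQ] := divide_linear hr.
have Q0 : Q != 0 by apply: contraNneq P0 => Q0; rewrite eQ Q0 scaler0.
have [||g [R [g0 eR pR]]] := IH Q => //.
  move: sz; rewrite eQ lead_coefZ size_mul ?polyXsubC_eq0 ?lead_coef_eq0 // size_XsubC.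
  by rewrite !ltnS.
exists (('X - r%:P) * g), R; rewrite mulf_neq0 ?polyXsubC_eq0 //; split=> //.
by rewrite eQ eR scalerA.
Qed.

(** Gauss's lemma, one root [r] of [c] at a time: [P] stays nonzero at [x = r], so [q] vanishes
    there and [x - r] cancels. *)
Lemma primitive_dvd P Z c q : primitive_x P -> c != 0 -> c *: Z = q * P ->
  exists q', Z = q' * P.
Proof.
move=> pP; have [k] := ubnP (size c); elim: k c q => // k IH c q sz c0 e.
have [/eqP/size_poly1P[a a0 ec]|s1] := eqVneq (size c) 1%N.
  exists (a^-1%:P *: q); rewrite -scalerAl -e ec scalerA -polyCM mulVf //.
  by rewrite scale1r.
have /closed_rootP[r rc] := s1.
have [i hi] := pP r.
pose ev := map_poly (horner_eval r).
have evP0 : ev P != 0.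
  apply/eqP => /polyP/(_ i); rewrite coef_map coef0 /= /horner_eval => /eqP.
  exact: (negP hi).
have evq : ev q = 0.
  have : ev (c *: Z) = ev q * ev P by rewrite e /ev rmorphM.
  rewrite /ev map_polyZ /= /horner_eval (rootP rc) scale0r => /esym/eqP.
  by rewrite mulf_eq0 (negPf evP0) orbF => /eqP.
have [q1 eq1] : exists q1, q = ('X - r%:P) *: q1.
  apply: divide_linear => j; apply/rootP.
  by move/polyP/(_ j): evq; rewrite coef_map coef0.
have /factor_theorem[c1 ec] := rc.
have c10 : c1 != 0 by apply: contraNneq c0 => h; rewrite ec h mul0r.
apply: (IH c1 q1) => //.
  by move: sz; rewrite ec size_mul ?polyXsubC_eq0 // size_XsubC addn2.
have XP : ('X - r%:P)%:P != 0 :> {poly {poly C}} by rewrite polyC_eq0 polyXsubC_eq0.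
apply: (mulfI XP); rewrite !mul_polyC.
by rewrite scalerA mulrC -ec e eq1 scalerAl.
Qed.

(** [del] raises the degree in [X] by at most one, so [q] has degree at most one, and the
    coefficient of [X^(m+1)] fixes its slope as [-m]. *)
Lemma cofactor_linear P q m : size P = m.+1 -> del P = q * P ->
  exists al, del P = (al%:P - m%:R *: 'X) * P.
Proof.
move=> sP e; have P0 : P != 0 by rewrite -size_poly_gt0 sP.
have lP : P`_m != 0 by have := lead_coef_eq0 P; rewrite /lead_coef sP => ->.
have sq : (size q <= 2)%N.
  have [->|q0] := eqVneq q 0; first by rewrite size_poly0.
  have := size_riccati derd V P; rewrite -/del e size_mul // sP addnS /=.
  by rewrite -[m.+2]/(2 + m)%N leq_add2r.
have eq : q = (q`_0)%:P + q`_1 *: 'X.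
  apply/polyP => -[|[|i]]; rewrite coefD coefC coefZ coefX /= ?mulr0 ?mulr1 ?addr0 ?add0r //.
  by rewrite nth_default // (leq_trans sq).
exists q`_0; rewrite e {1}eq; congr ((_ + _) * _); rewrite -scaleNr; congr (_ *: _).
move/polyP/(_ m.+1): e; rewrite {1}/del coef_riccatiS // [X in X * P]eq mulrDl.
rewrite coefD coefCM -scalerAl coefZ coefXM /=.
have Pz j : (m < j)%N -> P`_j = 0 by move=> hj; rewrite nth_default ?sP.
rewrite (Pz m.+1) // (Pz m.+2) // deriv0 mul0rn !mulr0 !add0r -[_ *+ m]mulr_natl -mulNr.
by move/(mulIf lP).
Qed.

(** With [p] the leading coefficient, the root [p'/p - al] of [P] is the logarithmic derivative of
    [p exp(-int al)]; the equation for [p] says that this function solves [psi'' = V psi]. *)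
Lemma linear_darboux P al : size P = 2 -> del P = (al%:P - 1%:R *: 'X) * P ->
  exists2 p, p != 0 & p^`()^`() = (V + al^`() - al ^+ 2) * p + 2%:R * al * p^`().
Proof.
move=> sP e; exists P`_1.
  by have := lead_coef_eq0 P; rewrite /lead_coef sP => ->; rewrite -size_poly_eq0 sP.
have P2 : P`_2 = 0 by rewrite nth_default ?sP.
have := congr1 (fun Q => Q`_0) e; have := congr1 (fun Q => Q`_1) e.
rewrite /del coef_riccatiS // coef_riccati0 // P2 mul0rn !mulr0 mulr0n subr0 addr0.
rewrite scale1r mulrBl !coefB !coefCM !coefXM /= subr0 => e1 e0.
have p0 : P`_0 = al * P`_1 - (P`_1)^`() by rewrite e1 subKr.
move: e0; rewrite p0 derivB derivM => /eqP; rewrite -subr_eq0 => /eqP e0.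
by apply/eqP; rewrite -subr_eq0; apply/eqP; apply: oppr_inj; rewrite oppr0 -[RHS]e0; ring.
Qed.

(** * The discriminant of a Darboux polynomial *)

Local Notation coef_row n Q := (@poly_rV {poly C} n Q).

(* Row [i] lists the coefficients of [X^i] under the derivation of binary forms
   of degree [n.-1], dehomogenised. *)
Definition form_mx n : 'M[{poly C}]_n :=
  \matrix_(i < n) coef_row n (del 'X^i + n.-1%:R *: 'X^(i.+1)).

(** Only [i = n - 1] could produce [X^n], and there the added multiple cancels it. *)
Lemma size_form n i : (i < n)%N -> (size (del 'X^i + n.-1%:R *: 'X^(i.+1))%R <= n)%N.
Proof.
move=> hi; apply/leq_sizeP => -[|j] hj; first by rewrite leqNgt (leq_ltn_trans _ hi) in hj.
have ij : (i <= j)%N by rewrite -ltnS (leq_trans hi).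
rewrite [LHS]coefD /del coef_riccatiS // coefZ !coefXn eqSS (gtn_eqF (_ : i < j.+1)%N) //.
rewrite (gtn_eqF (_ : i < j.+2)%N) ?ltnS ?(leqW ij) // deriv0 mul0rn mulr0 !add0r.
have [e|ne] := eqVneq j i; last by rewrite mul0rn oppr0 mulr0 addr0.
have -> : n.-1 = i by lia.
by rewrite e mulr1 addNr.
Qed.

(** Row [i] involves only [X^(i-1)] and [X^(i+1)]. *)
Lemma tr_form_mx n : \tr (form_mx n) = 0.
Proof.
apply: big1 => i _; rewrite !mxE coefD coefZ coefXn ltn_eqF // mulr0 addr0.
case: i => -[|i] hi /=; rewrite /del ?coef_riccati0 ?coef_riccatiS // !coefXn /=.
  by rewrite mulr0 addr0 -polyC1 derivC.
rewrite eqxx -polyC1 derivC (gtn_eqF (ltnSn _)) (ltn_eqF (ltnSn _)).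
by rewrite !mul0rn mulr0 addr0 subr0.
Qed.

Lemma poly_sumX n Q : (size Q <= n)%N -> Q = \sum_(i < n) Q`_i *: 'X^i.
Proof.
move=> sQ; rewrite -{1}[Q]coefK poly_def.
rewrite (big_ord_widen n (fun i => Q`_i *: 'X^i) sQ) big_mkcond /=.
apply: eq_bigr => i _; case: ifPn => // h.
by rewrite nth_default ?scale0r // leqNgt.
Qed.

Lemma coef_row_form n Q : (size Q <= n)%N ->
  coef_row n (del Q + n.-1%:R *: ('X * Q)) =
  map_mx (@deriv C) (coef_row n Q) + coef_row n Q *m form_mx n.
Proof.
move=> sQ; apply/rowP => j; rewrite !mxE.
have -> : del Q + n.-1%:R *: ('X * Q) =
    \sum_(i < n) ((Q`_i)^`() *: 'X^i + Q`_i *: (del 'X^i + n.-1%:R *: 'X^(i.+1))).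
  rewrite {1 2}(poly_sumX sQ) (der_sum derdel) mulr_sumr scaler_sumr -big_split /=.
  apply: eq_bigr => i _; rewrite riccatiZ -addrA [X in _ = _ + X]scalerDr; congr (_ + (_ + _)).
  by rewrite -scalerAr exprS !scalerA mulrC.
rewrite coef_sum; transitivity (\sum_(i < n) ((Q`_i)^`() * (j == i :> nat)%:R +
    Q`_i * (del 'X^i + n.-1%:R *: 'X^(i.+1))`_j)).
  by apply: eq_bigr => i _; rewrite [LHS]coefD; congr (_ + _); rewrite coefZ ?coefXn.
rewrite big_split /=; congr (_ + _); last by apply: eq_bigr => i _; rewrite !mxE.
rewrite (bigD1 j) //= eqxx mulr1 big1 ?addr0 // => i ij.
by rewrite eq_sym (inj_eq val_inj) (negPf ij) mulr0.
Qed.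

Lemma coef_row_mul n k Q (S : {poly {poly C}}) : (size S <= k)%N ->
  coef_row n (S * Q) = coef_row k S *m \matrix_(i < k, j < n) ('X^i * Q)`_j.
Proof.
move=> sS; apply/rowP => j; rewrite !mxE {1}(poly_sumX sS) mulr_suml coef_sum.
by apply: eq_bigr => i _; rewrite !mxE -scalerAl coefZ.
Qed.

(** One of the two row blocks of a Sylvester matrix. *)
Definition mul_mx k n Q : 'M[{poly C}]_(k, n) := \matrix_(i < k, j < n) ('X^i * Q)`_j.

(* If [P] has degree [m = k + 2], its dehomogenised partial derivatives are [P1] and
   [P2], and the determinant below is the discriminant of [P] up to a constant. *)
Section Discriminant.
Variables (k : nat) (P : {poly {poly C}}) (al : {poly C}).
Hypothesis sP : size P = k.+3.
Hypothesis eP : del P = (al%:P - k.+2%:R *: 'X) * P.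

Let P1 := P^`().
Let P2 : {poly {poly C}} := k.+2%:R *: P - 'X * P^`().
Let Phi : 'M[{poly C}]_(k.+1 + k.+1) :=
  col_mx (mul_mx k.+1 (k.+1 + k.+1) P1) (mul_mx k.+1 (k.+1 + k.+1) P2).

Let sP1 : (size P1 <= k.+2)%N.
Proof. by rewrite -ltnS -sP lt_size_deriv // -size_poly_gt0 sP. Qed.

Let sP2 : (size P2 <= k.+2)%N.
Proof.
apply/leq_sizeP => j hj; rewrite coefB coefZ coefXM; case: j hj => // j hj.
rewrite coef_deriv /=; move: hj; rewrite leq_eqVlt => /orP[/eqP [<-]|hj].
  by rewrite mulr_natl subrr.
by rewrite nth_default ?sP // mulr0 mul0rn subrr.
Qed.

(** Together with [dP2]: on the pair [(P1, P2)] the derivation of forms of degree [k + 1] acts by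
    the matrix with rows [(al, -1)] and [(-V, al)]. *)
Let dP1 : del P1 + k.+1%:R *: ('X * P1) = al *: P1 - P2.
Proof.
rewrite /P1 /P2 /del riccati_der_deriv // -/del eP derivM derivB derivC derivZ derivX sub0r.
by rewrite -!mul_polyC !rmorph_nat; ring.
Qed.

Let dP2 : del P2 + k.+1%:R *: ('X * P2) = al *: P2 - V *: P1.
Proof.
have dX : del 'X = V%:P - 'X^2.
  rewrite /del /riccati_der derivX mulr1; have -> : map_poly (@deriv C) 'X = 0; last by rewrite add0r.
  by apply/polyP => i; rewrite coef_map coefX coef0; case: (_ == _); rewrite /= ?deriv0 // -polyC1 derivC.
have e1 : del P1 = al *: P1 - P2 - k.+1%:R *: ('X * P1) by rewrite -dP1 addrK.
rewrite {1}/P2 (der_sub derdel) riccatiZ (der_mul derdel) dX -/P1 e1 eP /P2 -/P1.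
have -> : (k.+2%:R : {poly C})^`() = 0 by rewrite -polyC_natr derivC.
by rewrite scale0r -!mul_polyC !rmorph_nat; ring.
Qed.

Let size_XnM i Q : (i < k.+1)%N -> (size Q <= k.+2)%N -> (size ('X^i * Q)%R <= k.+1 + k.+1)%N.
Proof.
move=> hi sQ; rewrite addSn; apply: size_le_mul; first by rewrite size_polyXn.
by rewrite (leq_trans sQ) // addnS.
Qed.

(** The Leibniz rule on the rows [X^i P1] and [X^i P2]: the left factor comes from [X^i] and the
    system for [(P1, P2)], the right one from deriving a coefficient row as a form of degree
    [2 k + 1]. *)
Lemma map_disc_mx : map_mx (@deriv C) Phi =
  block_mx (form_mx k.+1 + al%:M) (- 1%:M) (- V%:M) (form_mx k.+1 + al%:M) *m Phi
  - Phi *m form_mx (k.+1 + k.+1).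
Proof.
pose N := (k.+1 + k.+1)%N.
have mx_eq (Q W : {poly {poly C}}) : (size Q <= k.+2)%N ->
    del Q + k.+1%:R *: ('X * Q) = W -> map_mx (@deriv C) (mul_mx k.+1 N Q) =
    form_mx k.+1 *m mul_mx k.+1 N Q + mul_mx k.+1 N W - mul_mx k.+1 N Q *m form_mx N.
  move=> sQ eW; apply/row_matrixP => i.
  have rowM Z : row i (mul_mx k.+1 N Z) = coef_row N ('X^i * Z).
    by apply/rowP => j; rewrite !mxE.
  rewrite linearB linearD /= !row_mul -map_row !rowM.
  apply/eqP; rewrite eq_sym subr_eq; apply/eqP.
  rewrite -coef_row_form; last exact: size_XnM.
  rewrite rowK -coef_row_mul; last exact: size_form.
  rewrite -eW; apply/rowP => j; rewrite !mxE -coefD.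
  apply: (congr1 (fun q : {poly {poly C}} => q`_j)).
  rewrite (der_mul derdel) -!mul_polyC !rmorph_nat.
  have -> : N.-1 = (k + k.+1)%N by [].
  by rewrite natrD exprS; ring.
have mulB Q W : mul_mx k.+1 N (Q - W) = mul_mx k.+1 N Q - mul_mx k.+1 N W.
  by apply/matrixP => i j; rewrite !mxE mulrBr coefB.
have mulZ c Q : mul_mx k.+1 N (c *: Q) = c *: mul_mx k.+1 N Q.
  by apply/matrixP => i j; rewrite !mxE -scalerAr coefZ.
rewrite mul_block_col !mulmxDl !mulNmx !mul_scalar_mx scale1r mul_col_mx.
rewrite map_col_mx opp_col_mx add_col_mx (mx_eq _ _ sP1 dP1) (mx_eq _ _ sP2 dP2).
rewrite (mulB (al *: P1) P2) (mulB (al *: P2) (V *: P1)) (mulZ al P1) (mulZ al P2) (mulZ V P1).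
by congr col_mx; rewrite ?addrA //; congr (_ - _); rewrite addrC addrA.
Qed.

(** A kernel vector gives [S P1 + T P2 = 0] with [S], [T] of degree at most [k], so
    [P' (S - X T) = -(k+2) T P]. By coprimality [P] divides [S - X T], whose degree is too small;
    hence [S = T = 0]. *)
Lemma disc_mx_neq0 : coprimep P P^`() -> \det Phi != 0.
Proof.
move=> cop; apply/negP => /det0P[v v0]; rewrite -(hsubmxK v) mul_row_col => e.
pose S := rVpoly (lsubmx v); pose T := rVpoly (rsubmx v).
have sz (u : 'rV[{poly C}]_k.+1) : (size (rVpoly u) <= k.+1)%N by apply: size_poly.
have STP : S * P1 + T * P2 = 0.
  apply/polyP => j; rewrite coef0.
  have [hj|hj] := ltnP j (k.+1 + k.+1); last first.
    rewrite nth_default // (leq_trans _ hj) // (leq_trans (size_polyD _ _)) // geq_max.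
    by apply/andP; split; rewrite addSn; apply: size_le_mul => //; apply: sz.
  move/rowP/(_ (Ordinal hj)): e; rewrite -{1}(rVpolyK (lsubmx v)) -{1}(rVpolyK (rsubmx v)).
  by rewrite -!coef_row_mul ?sz // !mxE coefD.
have e2 : P1 * (S - 'X * T) = - (k.+2%:R *: T) * P.
  apply/eqP; rewrite -subr_eq0 -STP /P2 -/P1; apply/eqP.
  by rewrite -!mul_polyC !rmorph_nat; ring.
have Z0 : S - 'X * T = 0.
  apply/eqP; apply: contraT => Z0.
  have : P %| S - 'X * T by rewrite -(Gauss_dvdpr _ cop) -/P1 e2 dvdp_mull.
  move/(dvdp_leq Z0); rewrite sP leqNgt ltnS (leq_trans (size_polyD _ _)) // geq_max size_polyN.
  rewrite (leq_trans (sz _)) // mulrC.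
  have [->|T0] := eqVneq T 0; first by rewrite mul0r size_poly0.
  by rewrite size_mulX ?ltnS ?sz.
have T0 : T = 0.
  move: e2; rewrite Z0 mulr0 => /esym/eqP; rewrite mulf_eq0 -[P == 0]size_poly_eq0 sP orbF.
  rewrite oppr_eq0 -mul_polyC mulf_eq0 => /orP[|/eqP //].
  by rewrite polyC_eq0 -polyC_natr polyC_eq0 pnatr_eq0.
have S0 : S = 0 by move: Z0; rewrite T0 mulr0 subr0.
case/negP: v0; rewrite -(hsubmxK v) -(rVpolyK (lsubmx v)) -(rVpolyK (rsubmx v)) -/S -/T.
by rewrite S0 T0 !linear0 row_mx0.
Qed.

(** [Delta = \det Phi] satisfies [Delta' = 2 (k+1) al Delta]; if [al != 0], the right side has
    degree at least that of [Delta]. *)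
Lemma cofactor_eq0 : coprimep P P^`() -> al = 0.
Proof.
move=> cop; have D0 := disc_mx_neq0 cop.
have := der_det_lin derd map_disc_mx.
rewrite mxtrace_block !mxtraceD !tr_form_mx !add0r subr0 mxtrace_scalar -mulr2n -mulrnA => e.
apply/eqP; apply: contraT => al0.
have := lt_size_deriv D0; rewrite e -[_ *+ _]mulr_natl -mulrA -polyC_natr size_Cmul; last by rewrite pnatr_eq0.
rewrite size_mul //; case: (size al) (size_poly_gt0 al) => [|s _]; first by rewrite al0.
by rewrite addSn /= ltnNge leq_addl.
Qed.
End Discriminant.

Lemma darboux_exponential n P : (0 < n)%N -> V \is monic -> size V = (2 * n).+1 ->
  (1 < size P)%N -> P %| del P ->
  exists al p : {poly C}, p != 0 /\
    p^`()^`() = (V + al^`() - al ^+ 2) * p + 2%:R * al * p^`().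
Proof.
move=> n0 mV sV; have [k] := ubnP (size P); elim: k P => // k IH P sz s1 dP.
have P0 : P != 0 by rewrite -size_poly_gt0 ltnW.
(* A repeated factor makes the gcd of [P] and [P'] a Darboux polynomial of smaller degree, to which
   induction applies. *)
have [sG|sG] := leqP (size (gcdp P P^`())) 1; last first.
  apply: (IH (gcdp P P^`())) => //; last exact: gcdp_darboux.
  have P'0 : P^`() != 0.
    have char0 i : i.+1%:R != 0 :> {poly C} by rewrite -polyC_natr polyC_eq0 pnatr_eq0.
    by apply: contraTneq s1 => /(deriv_eq0 char0) ->; rewrite -leqNgt size_polyC_leq1.
  apply: leq_ltn_trans (dvdp_leq P'0 (dvdp_gcdr _ _)) _.
  by apply: leq_trans (lt_size_deriv P0) _.
have cop : coprimep P P^`().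
  by rewrite /coprimep eqn_leq sG size_poly_gt0 gcdp_eq0 negb_and P0.
have [g [Q [g0 eQ pQ]]] := primitive_part P0.
have sQ : size Q = size P by rewrite eQ -mul_polyC size_Cmul.
have Q0 : Q != 0 by rewrite -size_poly_eq0 sQ size_poly_eq0.
have copQ : coprimep Q Q^`().
  by move: cop; rewrite eQ derivZ coprimepZl // coprimepZr.
have [q eq] : exists q, del Q = q * Q.
  move: dP; rewrite eQ riccatiZ dvdpZl // dvdp_addr; last by rewrite -mul_polyC dvdp_mull.
  rewrite dvdpZr // => /Pdiv.Idomain.dvdpP[[c q] /= c0 e].
  exact: (primitive_dvd pQ c0 e).
pose m := (size P).-1; have sm : size Q = m.+1 by rewrite sQ /m prednK // ltnW.
have [al e] := cofactor_linear sm eq.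
move: sm e; have : (0 < m)%N by rewrite -ltnS /m prednK // ltnW.
case: m => // -[|m] _ sm e.
  by have [p p0 ep] := linear_darboux sm e; exists al, p.
have al0 := cofactor_eq0 sm e copQ; rewrite al0 sub0r in e.
(* The coefficients of [Q] from the top, with a zero at either end: [f 0] stands for [X^(m+3)], and
   [f (m+4)] lies below the constant term. The identity [del Q = -(m+2) X Q] is the recurrence that
   forces [f (m+4) != 0]. *)
pose f i := if i is j.+1 then (if (j <= m.+2)%N then Q`_(m.+2 - j) else 0) else 0.
have fS j : (j <= m.+2)%N -> f j = Q`_((m.+2 - j).+1).
  case: j => [_|j hj]; first by rewrite nth_default // sm subn0.
  by rewrite /f ltnW // subnSK.
have : f m.+4 != 0.
  apply: (@recurrence_neq0 _ n V n0 mV sV m.+2) => // [|j hj].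
    by have := lead_coef_eq0 Q; rewrite /lead_coef sm /= subn0 => ->.
  rewrite (fS j) // -[f j.+1]/(if (j <= m.+2)%N then Q`_(m.+2 - j) else 0) hj.
  rewrite -[f j.+2]/(if (j < m.+2)%N then Q`_(m.+2 - j.+1) else 0).
  move: hj; rewrite leq_eqVlt => /orP[/eqP ->|hj].
    rewrite ltnn subnn scaler0; have := congr1 (fun R : {poly {poly C}} => R`_0) e.
    rewrite /del coef_riccati0 // mulNr coefN -scalerAl coefZ coefXM mulr0 oppr0 => e0.
    by rewrite scale1r -opprD e0 oppr0.
  rewrite hj -(subnSK hj); set i := (m.+2 - j.+1)%N.
  have := congr1 (fun R : {poly {poly C}} => R`_i.+1) e.
  rewrite /del coef_riccatiS // mulNr coefN -scalerAl coefZ coefXM /=.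
  have -> : m.+2%:R = i%:R + j.+1%:R :> {poly C} by rewrite -natrD /i subnK.
  rewrite -[_ *+ i]mulr_natl -[_ *+ i.+2]mulr_natl -!mul_polyC !polyC_natr => e'.
  move/eqP: e'; rewrite -subr_eq0 => /eqP e'; apply/eqP; rewrite -subr_eq0; apply/eqP.
  by rewrite -[RHS]e'; ring.
by rewrite /f ltnn eqxx.
Qed.
End Riccati.

(** * Eigenvalues *)

Section Eigen.
Variables (C : fieldType) (L : {poly C} -> {poly C}).
Hypothesis linL : forall a p q, L (a *: p + q) = a *: L p + L q.

Lemma eigenvectors_free (I : eqType) (lam : I -> C) (f : I -> {poly C}) (c : I -> C) (r : seq I) :
  injective lam -> (forall i, f i != 0) -> (forall i, L (f i) = lam i *: f i) ->
  uniq r -> \sum_(i <- r) c i *: f i = 0 -> forall i, i \in r -> c i = 0.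
Proof.
move=> lamI f0 ef; have L0 : L 0 = 0 by have := linL (-1) 0 0; rewrite scaleN1r oppr0 addr0 scaleN1r addNr.
elim: r c => // j r IH c /= /andP[jr ur] e.
have Lsum (r' : seq I) : L (\sum_(i <- r') c i *: f i) = \sum_(i <- r') (c i * lam i) *: f i.
  by elim: r' => [|x r' IH']; rewrite ?big_nil // !big_cons linL IH' ef scalerA.
have cr i : i \in r -> c i = 0.
  move=> ir; have : c i * (lam i - lam j) = 0.
    apply: (IH (fun i => c i * (lam i - lam j))) => //.
    transitivity (L (\sum_(i <- j :: r) c i *: f i) - lam j *: \sum_(i <- j :: r) c i *: f i).
      rewrite Lsum !big_cons scalerDr scaler_sumr [lam j *: (_ *: _)]scalerA [lam j * _]mulrC.
      rewrite opprD addrACA subrr add0r -sumrB; apply: eq_bigr => x _.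
      by rewrite scalerA -scalerBl mulrBr [lam j * _]mulrC.
    by rewrite e L0 scaler0 subr0.
  move/eqP; rewrite mulf_eq0 subr_eq0 (inj_eq lamI) => /orP[/eqP //|/eqP ij].
  by rewrite -ij ir in jr.
move=> i; rewrite inE => /orP[/eqP ->|]; last exact: cr.
move: e; rewrite big_cons big_seq big1 => [|x /cr ->]; last by rewrite scale0r.
by rewrite addr0 => /eqP; rewrite scaler_eq0 (negPf (f0 j)) orbF => /eqP.
Qed.

Lemma eigenvalues_bound d k (lam : 'I_k -> C) (f : 'I_k -> {poly C}) :
  injective lam -> (forall i, f i != 0) -> (forall i, (size (f i) <= d)%N) ->
  (forall i, L (f i) = lam i *: f i) -> (k <= d)%N.
Proof.
move=> lamI f0 sf ef.
pose M : 'M[C]_(k, d) := \matrix_(i < k) poly_rV (f i).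
have /eqP <- : row_free M; last exact: rank_leq_col.
apply: inj_row_free => v vM; apply/rowP => i; rewrite mxE.
apply: (eigenvectors_free (c := fun i => v 0 i) lamI f0 ef (index_enum_uniq _)); last exact: mem_index_enum.
have := congr1 rVpoly vM; rewrite linear0 mulmx_sum_row linear_sum => h.
by apply: etrans h; apply: eq_bigr => j _; rewrite linearZ /= rowK poly_rV_K.
Qed.
End Eigen.

(** * Comparison of degrees in [x] *)

Section Asymptotics.
Variables (C : numClosedFieldType) (n : nat) (A B : {poly C}).
Hypothesis n0 : (0 < n)%N.
Hypothesis monA : A \is monic.
Hypothesis sizeA : size A = n.+1.
Hypothesis sizeB : (size B <= n)%N.

(** If both factors of [E = (A - al) (A + al)] are nonzero, one has at least the larger of the
    degrees of [A] and [al], since their sum and difference are [2 A] and [-2 al]. Then [(E + B) p]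
    outgrows the remaining terms. The exponent [b.+1] makes the exponential factor
    [exp((-1)^b int A)]. *)
Lemma exponent_unique (al p : {poly C}) : p != 0 ->
  p^`()^`() = (A ^+ 2 + B + al^`() - al ^+ 2) * p + 2%:R * al * p^`() ->
  exists b : bool, al = (-1) ^+ b.+1 * A.
Proof.
move=> p0 e; apply: NNPP => ne.
have a1 : A - al != 0.
  apply: contra_notN ne; rewrite subr_eq0 => /eqP <-.
  by exists true; rewrite sqrrN expr1n mul1r.
have a2 : A + al != 0.
  apply: contra_notN ne; rewrite addrC addr_eq0 => /eqP ->.
  by exists false; rewrite expr1 mulN1r.
have [W [W1 W2 W3]] : exists W, [/\ n.+1 <= W, size al <= W & (W == n.+1) || (W == size al)]%N.
  exists (maxn n.+1 (size al)); rewrite leq_maxl leq_maxr; split=> //.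
  by case: leqP => _; rewrite eqxx ?orbT.
have two : 2%:R != 0 :> C by rewrite pnatr_eq0.
have big : (W <= size (A - al)%R)%N \/ (W <= size (A + al)%R)%N.
  apply: NNPP => /not_or_and[/negP h1 /negP h2]; rewrite -!ltnNge in h1 h2.
  have hA : (size (2%:R *: A) < W)%N.
    rewrite (_ : 2%:R *: A = (A - al) + (A + al)); last by rewrite -mul_polyC polyC_natr; ring.
    by rewrite (leq_ltn_trans (size_polyD _ _)) // gtn_max h1 h2.
  have hal : (size (2%:R *: al) < W)%N.
    rewrite (_ : 2%:R *: al = (A + al) - (A - al)); last by rewrite -mul_polyC polyC_natr; ring.
    by rewrite (leq_ltn_trans (size_polyD _ _)) // gtn_max size_polyN h1 h2.
  have hA' : (n.+1 < W)%N by rewrite -sizeA -(size_scale A two).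
  have hal' : (size al < W)%N by rewrite -(size_scale al two).
  by clear -hA' hal' W3; lia.
pose E := (A - al) * (A + al).
have sE : (W <= size E)%N.
  have s1 : (0 < size (A - al)%R)%N by rewrite size_poly_gt0.
  have s2 : (0 < size (A + al)%R)%N by rewrite size_poly_gt0.
  have sE' : size E = (size (A - al)%R + size (A + al)%R).-1 by rewrite size_mul.
  by case: big => h; clear -s1 s2 sE' h; lia.
have sEB : size (E + B) = size E.
  by rewrite size_polyDl // (leq_ltn_trans sizeB) // (leq_trans W1).
have eE : (E + B) * p = p^`()^`() - al^`() * p - 2%:R * al * p^`().
  by rewrite e /E; ring.
have EB0 : E + B != 0 by rewrite -size_poly_gt0 sEB (leq_trans _ sE) // (leq_trans _ W1).
have pp : (0 < size p)%N by rewrite size_poly_gt0.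
have szder (q : {poly C}) : (size q^`() <= (size q).-1)%N.
  have [->|q0] := eqVneq q 0; first by rewrite deriv0 size_poly0.
  have h : (size q^`() < size q)%N by apply: lt_size_deriv.
  by clear -h; lia.
have szM (q r : {poly C}) : (size (q * r)%R <= (size q + size r).-1)%N by apply: size_polyMleq.
have szB (q r : {poly C}) k : (size q <= k)%N -> (size r <= k)%N -> (size (q - r)%R <= k)%N.
  by move=> hq hr; rewrite (leq_trans (size_polyD _ _)) // geq_max size_polyN hq.
have h1 : (size (p^`()^`()) <= (W + size p).-2)%N.
  by have := szder p^`(); have := szder p; clear -pp W1; lia.
have h2 : (size (al^`() * p)%R <= (W + size p).-2)%N.
  by have := szM al^`() p; have := szder al; clear -pp W1 W2; lia.
have h3 : (size (2%:R * al * p^`())%R <= (W + size p).-2)%N.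
  have := szM (2%:R * al) p^`(); have := szder p.
  have -> : size (2%:R * al) = size al by rewrite -polyC_natr size_Cmul.
  by clear -pp W1 W2; lia.
have h4 : (size ((E + B) * p)%R <= (W + size p).-2)%N by rewrite eE; apply: (szB) => //; apply: szB.
have h5 : size ((E + B) * p) = (size E + size p).-1 by rewrite size_mul ?sEB.
by rewrite h5 in h4; clear -h4 sE pp W1; lia.
Qed.

(** Coefficient of [x^(n-1+N)] with [N = deg p]: [p''] does not reach it, while [A p'] and [A' p]
    give [N] and [n] times the leading coefficient of [p]. *)
Lemma degree_relation (b : bool) p : p != 0 ->
  p^`()^`() + (2%:R * (-1) ^+ b) * (A * p^`()) + ((-1) ^+ b * A^`() - B) * p = 0 ->
  B`_n.-1 = (-1) ^+ b * (2 * (size p).-1 + n)%:R.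
Proof.
move=> p0 e; pose N := (size p).-1.
have sp : size p = N.+1 by rewrite /N prednK // size_poly_gt0.
have lp : p`_N != 0 by have := lead_coef_eq0 p; rewrite /lead_coef sp => ->.
have An : A`_n = 1 by have := monicP monA; rewrite /lead_coef sizeA.
have sA' : (size A^`() <= n.-1.+1)%N.
  by rewrite prednK // -ltnS -sizeA lt_size_deriv // monic_neq0.
have c0 : (p^`()^`())`_(n.-1 + N) = 0.
  by rewrite !coef_deriv nth_default ?mul0rn // sp; lia.
have c1 : (A * p^`())`_(n.-1 + N) = N%:R * p`_N.
  have [N0|N1] := posnP N.
    have -> : p^`() = 0 by rewrite (size1_polyC (_ : size p <= 1)%N) ?derivC // sp N0.
    by rewrite N0 mulr0 coef0 mul0r.
  have -> : (n.-1 + N = n + N.-1)%N by lia.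
  rewrite coefM_top ?sizeA // ?An ?mul1r ?coef_deriv ?prednK ?mulr_natl //.
  by rewrite -ltnS -sp lt_size_deriv.
have c2 : (A^`() * p)`_(n.-1 + N) = n%:R * p`_N.
  by rewrite coefM_top ?sp // coef_deriv prednK // An.
have c3 : (B * p)`_(n.-1 + N) = B`_n.-1 * p`_N.
  by rewrite coefM_top ?sp // prednK.
move/polyP/(_ (n.-1 + N)%N): e; rewrite coef0.
have -> : p^`()^`() + (2%:R * (-1) ^+ b) * (A * p^`()) + ((-1) ^+ b * A^`() - B) * p =
   p^`()^`() + (2%:R * (-1) ^+ b) *: (A * p^`()) + (-1) ^+ b *: (A^`() * p) - B * p.
  rewrite -!mul_polyC polyCM polyC_natr rmorphXn rmorphN rmorph1 /=; ring.
rewrite coefB coefD coefD !coefZ c0 c1 c2 c3 add0r => h.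
apply: (mulIf lp); apply/eqP; rewrite eq_sym -subr_eq0; apply/eqP; rewrite -[RHS]h.
by rewrite natrD natrM; ring.
Qed.
End Asymptotics.

(** [lam] is absorbed into the constant term of [B1], which leaves the coefficient of index [n - 1]
    alone since [1 < n], and returns at the end as an eigenvalue. *)
Lemma liouvillian_exponential (C : numClosedFieldType) (n : nat) (A B : {poly C}) (lam : C) :
  (1 < n)%N -> A \is monic -> size A = n.+1 -> (size B <= n)%N ->
  has_liouvillian_solution (lam%:P + (A ^+ 2 + B)) ->
  exists (b : bool) (p : {poly C}), [/\ p != 0,
    B`_n.-1 = (-1) ^+ b * (2 * (size p).-1 + n)%:R &
    p^`()^`() + (2%:R * (-1) ^+ b) * (A * p^`()) + ((-1) ^+ b * A^`() - B) * p = lam *: p].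
Proof.
move=> n1 mA sA sB; have n0 : (0 < n)%N := ltnW n1.
pose B1 := B + lam%:P; have -> : lam%:P + (A ^+ 2 + B) = A ^+ 2 + B1 by rewrite /B1; ring.
have sB1 : (size B1 <= n)%N.
  rewrite (leq_trans (size_polyD _ _)) // geq_max sB.
  by rewrite (leq_trans (size_polyC_leq1 _)).
have A0 : A != 0 by rewrite monic_neq0.
have sA2 : size (A ^+ 2) = (2 * n).+1 by rewrite expr2 size_mul // sA; lia.
have lt : (size B1 < size (A ^+ 2))%N by rewrite sA2 (leq_ltn_trans sB1) // ltnS; lia.
have sV : size (A ^+ 2 + B1) = (2 * n).+1 by rewrite size_polyDl.
have mV : A ^+ 2 + B1 \is monic.
  by rewrite monicE lead_coefDl // -monicE monic_exp.
case/liouvillian_darboux => P [s1 dP].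
have [al [p [p0 e]]] := darboux_exponential n0 mV sV s1 dP.
have [b eal] := exponent_unique sA sB1 p0 e.
have e' : p^`()^`() + (2%:R * (-1) ^+ b) * (A * p^`()) + ((-1) ^+ b * A^`() - B1) * p = 0.
  rewrite e eal; case: b {eal}; rewrite ?expr0 ?expr1 ?sqrrN ?expr1n ?mulN1r ?mul1r ?derivN; ring.
exists b, p; split=> //.
  rewrite -(degree_relation n0 mA sA sB1 p0 e') coefD coefC.
  by case: n n1 {n0 sA sB sB1 sA2 lt sV} => [|[]] //= ? _; rewrite addr0.
apply/eqP; rewrite -subr_eq0 -e' /B1 -mul_polyC; apply/eqP; ring.
Qed.

(** * Counting the eigenvalues *)

Theorem mainTheorem10 (C : numClosedFieldType) (n : nat) (U A B : {poly C}) :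
  (2 <= n)%N ->
  size U = (2 * n).+1 ->
  (- U) \is monic ->
  A \is monic -> size A = n.+1 ->
  (size B <= n)%N ->
  - U = A ^+ 2 + B ->
  (exists lam : C, has_liouvillian_solution (lam%:P - U)) ->
  (exists k : nat, arith_cond n B = k%:R) /\
  (forall k : nat, arith_cond n B = k%:R ->
     forall s : seq C, uniq s ->
       (forall lam, lam \in s -> has_liouvillian_solution (lam%:P - U)) ->
       (size s <= k.+1)%N).
Proof.
move=> n1 _ _ mA sA sB eU ex.
have arithE (b : bool) N : B`_n.-1 = (-1) ^+ b * (2 * N + n)%:R -> arith_cond n B = N%:R.
  move=> e; rewrite /arith_cond e normrM normr_sign mul1r normr_nat natrD addrK natrM.
  by rewrite mulrC mulKf // pnatr_eq0.
have sol lam : has_liouvillian_solution (lam%:P - U) -> _ :=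
  fun h => liouvillian_exponential n1 mA sA sB (eq_rect _ _ h _ (congr1 (+%R lam%:P) eU)).
case: ex => lam0 /sol[b0 [p0 [_ e0 _]]].
split=> [|k ek s us hs]; first by exists (size p0).-1; apply: arithE e0.
(* By the degree relation, every polynomial factor has degree exactly [k]. *)
have kE (b : bool) N : B`_n.-1 = (-1) ^+ b * (2 * N + n)%:R -> N = k.
  by move/arithE; rewrite ek => /eqP; rewrite eqr_nat => /eqP.
have /fin_all_exists[f hf] (i : 'I_(size s)) : exists p : {poly C}, [/\ p != 0, (size p <= k.+1)%N &
    p^`()^`() + (2%:R * (-1) ^+ b0) * (A * p^`()) + ((-1) ^+ b0 * A^`() - B) * p = nth 0 s i *: p].
  have [b [p [p1 e h]]] := sol _ (hs _ (mem_nth 0 (ltn_ord i))).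
  exists p; split=> //; first by rewrite -(kE _ _ e) prednK // size_poly_gt0.
  (* As [2 k + n != 0], the sign can be read off [b_(n-1)], so all the polynomials are eigenvectors
     of the same operator. *)
  suff -> : b0 = b by [].
  move: (e) (e0); rewrite (kE _ _ e) (kE _ _ e0) => -> /eqP.
  have nz : (2 * k + n)%:R != 0 :> C by rewrite pnatr_eq0; lia.
  by rewrite (inj_eq (mulIf nz)) => /eqP/signr_inj.
pose L (p : {poly C}) :=
  p^`()^`() + (2%:R * (-1) ^+ b0) * (A * p^`()) + ((-1) ^+ b0 * A^`() - B) * p.
apply: (@eigenvalues_bound _ L _ k.+1 (size s) (fun i => nth 0 s i) f).
- move=> a p q; rewrite /L !derivD !derivZ -!mul_polyC; ring.
- by move=> i j /eqP; rewrite nth_uniq // => /eqP/val_inj.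
- by move=> i; have [] := hf i.
- by move=> i; have [] := hf i.
- by move=> i; have [] := hf i.
Qed.
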